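(* Consider the velocity nonholonomic variational integrator (determined by the finite difference map $\rho(q_k,q_{k+1})=\left(\frac{q_k+q_{k+1}}2,\frac{q_{k+1}-q_k}{\epsilon}\right)$) given by the scheme $(\tilde q_k,v_k)\mapsto(\tilde q_{k+1},v_{k+1})$, $$\tilde q_{k+1/2}=\tilde q_k+\tfrac12\epsilon v_k,\qquad \tilde q_{k+1}=\tilde q_{k+1/2}+\tfrac12\epsilon v_{k+1},$$ $$v_{k+1}=v_k-\tfrac12\epsilon M^{-1}\left(\nabla_qV(\tilde q_{k+1})+\nabla_qV(\tilde q_k)\right)+\epsilon(\lambda_{k+1})_\alpha M^{-1}\mu^\alpha(\tilde q_{k+1/2}),$$ $$\mu^\alpha(\tilde q_{k+1})\,v_{k+1}=0,$$ with initial conditions satisfying $\mu^\alpha(\tilde q_k)v_k=0$, where the multipliers $(\lambda_{k+1})_\alpha$ are determined by the last equation. This scheme is a $(2,0)$ consistent discretization of the nonholonomic flow given by the ODE on $D=\{(q,v):\mu^\alpha(q)v=0,\ \alpha=1,\dots,m\}$ $$\dot q=v,\qquad \dot v=-M^{-1}\nabla_qV(q)+\lambda_\alpha(q,v)M^{-1}\mu^\alpha(q),$$ where $$\lambda_\alpha(q,v)=-C_{\alpha\beta}(q)\left(\frac{\partial\mu^\beta_i(q)}{\partial q^j}v^iv^j-\mu^\beta(q)M^{-1}\nabla_qV(q)\right).$$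
   Context: Repeated indices are summed. $Q=\mathbb{R}^n$; the Lagrangian is $L(q,\dot q)=\frac12\dot q^TM\dot q-V(q)$ with $M$ a constant symmetric positive definite $n\times n$ mass matrix and $V$ a smooth potential. $\mu^\alpha(q)=\mu^\alpha_i(q)dq^i$, $\alpha=1,\dots,m$, are smooth one-forms, linearly independent at each $q$; $\mu^\alpha(q)v=\mu^\alpha_i(q)v^i$, $M^{-1}\mu^\alpha$ is the vector $(M^{-1})^{ij}\mu^\alpha_j$, and $(C_{\alpha\beta}(q))$ is the inverse of the matrix $(C^{\alpha\beta}(q))=(\mu^\alpha_i(q)(M^{-1})^{ij}\mu^\beta_j(q))$. The step size $\epsilon>0$ is small, and the scheme is understood as the locally defined solution branch $(v_{k+1},\lambda_{k+1})$ with $v_{k+1}\to v_k$ and $\lambda_{k+1}$ bounded as $\epsilon\to0$. $(p,s)$ consistent discretization (order $(p,s)$ discretization of the nonholonomic problem): a sequence $\{(q_k,v_{q_k},\lambda_k)\}\subset\mathbb{R}^{2n+m}$ with $v_{q_k}\in D_{q_k}$ (i.e. $\mu^\alpha(q_k)v_{q_k}=0$) for all $k$, such that $|q(t_k+\epsilon)-q_{k+1}|=O(\epsilon^{r+1})$, $|v(t_k+\epsilon)-v_{q_{k+1}}|=O(\epsilon^{l+1})$ with $\min(r,l)=p$, and $|\lambda(t_k+\epsilon)-\lambda_{k+1}|=O(\epsilon^{s+1})$ with $s\ge0$, as $\epsilon\to0$. Here $(q(t),v(t))$ is the solution of the nonholonomic ODE with $(q(t_k),v(t_k))=(q_k,v_{q_k})$,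 and $\lambda(t)=\lambda(q(t),v(t))$. In the present case $q_k$ is replaced by $\tilde q_k$ and $v_{q_k}$ by $v_k$. *)

(* Defs.v *)
From HB Require Import structures.
From mathcomp Require Import all_boot all_order all_algebra.
From mathcomp Require Import all_classical all_reals all_analysis.

Set Implicit Arguments.
Unset Strict Implicit.
Unset Printing Implicit Defensive.
Import Order.TTheory GRing.Theory Num.Theory.
Import numFieldNormedType.Exports.

Local Open Scope classical_set_scope.
Local Open Scope ring_scope.

Section Calculus.
Context {R : realType} {n : nat}.

Definition dcoord (i : 'I_n) (f : 'cV[R]_n -> R) (q : 'cV[R]_n) : R :=
  'D_(delta_mx i 0) f q.

Definition grad (f : 'cV[R]_n -> R) (q : 'cV[R]_n) : 'cV[R]_n :=
  \col_i dcoord i f q.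

Fixpoint Cdiff (k : nat) (f : 'cV[R]_n -> R) : Prop :=
  if k is k'.+1 then
    (forall q, differentiable f q) /\ (forall i, Cdiff k' (dcoord i f))
  else continuous f.

Definition smooth (f : 'cV[R]_n -> R) : Prop := forall k, Cdiff k f.

Definition sym_posdef (M : 'M[R]_n) : Prop :=
  M^T = M /\ forall x : 'cV[R]_n, x != 0 -> 0 < (x^T *m M *m x) 0 0.

End Calculus.

(* Vectors of R^n are columns.  The one-forms are the rows of a matrix-valued *)
(* map: mu q a i is the i-th component of the a-th form at q, so that         *)
(* mu q *m v collects the numbers mu^a(q) v, and invmx M *m (mu q)^T *m l is  *)
(* the sum over a of l_a M^-1 mu^a(q).                                        *)
Section Nonholonomic.
Context {R : realType} {n m : nat}.
Variables (M : 'M[R]_n) (V : 'cV[R]_n -> R) (mu : 'cV[R]_n -> 'M[R]_(m, n)).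
Implicit Types (q v : 'cV[R]_n) (l : 'cV[R]_m).

Definition inD q v : Prop := mu q *m v = 0.

Definition Cup q : 'M[R]_m := mu q *m invmx M *m (mu q)^T.

(* Cup q is a Gram matrix, hence invertible when M is symmetric positive      *)
(* definite and the forms are independent; invmx is then its inverse.         *)
Definition Clow q : 'M[R]_m := invmx (Cup q).

Definition dmu_vv q v : 'cV[R]_m :=
  \col_b \sum_i \sum_j dcoord j (fun x => mu x b i) q * v i 0 * v j 0.

Definition lambda q v : 'cV[R]_m :=
  - (Clow q *m (dmu_vv q v - mu q *m invmx M *m grad V q)).

Definition accel q v : 'cV[R]_n :=
  - (invmx M *m grad V q) + invmx M *m (mu q)^T *m lambda q v.

Definition flow_solution (t0 : R) (q v : R -> 'cV[R]_n) : Prop :=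
  \forall t \near t0, [/\ inD (q t) (v t),
    is_derive t 1 q (v t) & is_derive t 1 v (accel (q t) (v t))].

(* A one-step method: step e q v q' v' l' says that, with step size e, the    *)
(* method can send (q, v) to (q', v') with multiplier l'.                     *)
Definition one_step : Type :=
  R -> 'cV[R]_n -> 'cV[R]_n -> 'cV[R]_n -> 'cV[R]_n -> 'cV[R]_m -> Prop.

(* The step equations are implicit; a branch is a family of solutions defined *)
(* for all small e > 0, with v' converging to v and l' bounded as e -> 0.     *)
Definition is_branch (step : one_step) q v
    (q' v' : R -> 'cV[R]_n) (l' : R -> 'cV[R]_m) : Prop :=
  [/\ \forall e \near 0^'+, step e q v (q' e) (v' e) (l' e),
      v' e @[e --> 0^'+] --> v &
      exists K : R, \forall e \near 0^'+, `|l' e| <= K].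

(* Local truncation errors, from an arbitrary point (qk, vk) of D reached at  *)
(* an arbitrary time tk, the limit being taken with this point fixed.  The    *)
(* norms are sup norms, which does not affect O-estimates.                    *)
Definition consistent_discretization (p s : nat) (step : one_step) : Prop :=
  exists r l : nat, minn r l = p /\
  forall qk vk, inD qk vk ->
    (exists (q' v' : R -> 'cV[R]_n) (l' : R -> 'cV[R]_m),
       is_branch step qk vk q' v' l') /\
    forall (q' v' : R -> 'cV[R]_n) (l' : R -> 'cV[R]_m),
      is_branch step qk vk q' v' l' ->
      (\forall e \near 0^'+, inD (q' e) (v' e)) /\
      forall (tk : R) (q v : R -> 'cV[R]_n),
        flow_solution tk q v -> q tk = qk -> v tk = vk ->
        [/\ (fun e => q (tk + e) - q' e) =O_ (0^'+) (fun e : R => e ^+ r.+1),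
            (fun e => v (tk + e) - v' e) =O_ (0^'+) (fun e : R => e ^+ l.+1) &
            (fun e => lambda (q (tk + e)) (v (tk + e)) - l' e)
              =O_ (0^'+) (fun e : R => e ^+ s.+1)].

Definition velocity_integrator : one_step :=
  fun e q v q' v' l' =>
    let qh := q + (2^-1 * e) *: v in
    [/\ q' = qh + (2^-1 * e) *: v',
        v' = v - (2^-1 * e) *: (invmx M *m (grad V q' + grad V q))
               + e *: (invmx M *m (mu qh)^T *m l') &
        inD q' v'].

End Nonholonomic.

(* Main.v *)
(* Along an exact solution the velocity has a polynomial expansion of every order
   at the initial time: expansions pass to smooth functions of the position, to
   the multiplier and hence to the acceleration, and integrating gains one order.
   So the trapezoidal rule for the position and for the force, together with the
   midpoint rule for the reaction force, have error O(e^3).  Since the Gram matrix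
   mu M^-1 mu^T is invertible, the constraint at the new point bounds e times the
   multiplier error by the position error, up to O(e^3); the position error is
   itself e times the velocity error up to O(e^3), and for small e everything is
   absorbed.  A branch exists because the discrete acceleration (v' - v) / e is a
   fixed point of a contraction of a fixed ball when e is small. *)

(* The errors are coupled in a loop: the position depends on the velocity, the velocity on the
   multiplier, and the multiplier, through the constraint, on the position again. The loop closes
   because its first link carries a factor e. The constraint controls only e times the multiplier
   error, so O(e^3) there means O(e^2) for the multiplier, and this against the exact multiplier at
   the midpoint time. Moving to the end time costs O(e), which is why the multiplier has order 0.
   For existence the obstacle is that the equations degenerate at e = 0: the multiplier enters with
   a factor e, and the constraint no longer determines it. Since v satisfies the constraint at q,
   the constraint at the new point can be divided by e. With a = (v' - v) / e as unknown, the new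
   position depends on a only through e^2, so the quotient left by this division still has a
   Lipschitz constant O(e) in a. *)
From HB Require Import structures.
Require Import Defs.
From mathcomp Require Import all_boot all_order all_algebra perm.
From mathcomp Require Import all_classical all_reals all_analysis.
From mathcomp Require Import ring lra.

Set Implicit Arguments.
Unset Strict Implicit.
Unset Printing Implicit Defensive.
Import Order.TTheory GRing.Theory Num.Theory.
Import numFieldNormedType.Exports.

Local Open Scope classical_set_scope.
Local Open Scope ring_scope.

(** * Matrix norms and local Lipschitz bounds *)

Section MatrixNorm.
Context {R : realType}.

Lemma mx_entry_le m n (A : 'M[R]_(m, n)) i j : `|A i j| <= `|A|.
Proof.
rewrite [leRHS]/Num.Def.normr/= mx_normrE.
exact: (le_bigmax _ (fun ij => `|A ij.1 ij.2|) (i, j)).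
Qed.

Lemma mx_norm_le m n (A : 'M[R]_(m, n)) (c : R) :
  0 <= c -> (forall i j, `|A i j| <= c) -> `|A| <= c.
Proof.
move=> c0 h; rewrite [leLHS]/Num.Def.normr/= mx_normrE.
by apply: bigmax_le => // -[i j] _; exact: h.
Qed.

Lemma mulmx_norm_le m n p (A : 'M[R]_(m, n)) (B : 'M[R]_(n, p)) :
  `|A *m B| <= n%:R * `|A| * `|B|.
Proof.
apply: mx_norm_le => [|i j]; first by rewrite !mulr_ge0.
rewrite mxE (le_trans (ler_norm_sum _ _ _))//.
apply: (@le_trans _ _ (\sum_(k < n) `|A| * `|B|)); last first.
  by rewrite sumr_const card_ord -mulrA mulr_natl.
by apply: ler_sum => k _; rewrite normrM; apply: ler_pM => //; exact: mx_entry_le.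
Qed.

Lemma mulmx_le m n p (A : 'M[R]_(m, n)) (B : 'M[R]_(n, p)) (a b : R) :
  `|A| <= a -> `|B| <= b -> `|A *m B| <= n%:R * a * b.
Proof.
move=> Aa Bb; rewrite (le_trans (mulmx_norm_le _ _))// -!mulrA ler_wpM2l//.
exact: ler_pM.
Qed.

Lemma trmx_norm m n (A : 'M[R]_(m, n)) : `|A^T| = `|A|.
Proof.
have le k l (B : 'M[R]_(k, l)) : `|B^T| <= `|B|.
  by apply: mx_norm_le => // i j; rewrite mxE; exact: mx_entry_le.
by apply/eqP; rewrite eq_le le -{1}[A]trmxK le.
Qed.

End MatrixNorm.

Section Segment.
Context {R : realType}.

(** The one-variable mean value theorem for s in [0, 1]. On the real line this parametrization
    treats increments of both signs at once. *)
Lemma segment_mvt (U : normedModType R) (f : U -> R) (x h : U) :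
  (forall s : R, 0 <= s <= 1 -> differentiable f (x + s *: h)) ->
  exists2 c : R, 0 <= c <= 1 & f (x + h) - f x = 'd f (x + c *: h) h.
Proof.
move=> df; pose g (s : R) := f (x + s *: h).
have dl (s : R) : is_diff s (fun s : R => x + s *: h) (fun s => s *: h).
  have -> : (fun s : R => x + s *: h) = cst x + (fun s : R => s *: h) by [].
  by apply: is_diff_eq; rewrite add0r.
have gD (s : R) : 0 <= s <= 1 -> differentiable g s.
  by move=> s01; apply: differentiable_comp => //; exact: df.
have gE (s : R) : 0 <= s <= 1 -> is_derive s 1 g ('d f (x + s *: h) h).
  move=> s01; have gd := gD s s01.
  apply: DeriveDef; first exact: diff_derivable.
  rewrite deriveE// /g.
  rewrite (_ : (fun s0 : R => f (x + s0 *: h)) = f \o (fun s => x + s *: h))//.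
  rewrite diff_comp//=; last exact: df.
  by rewrite diff_val scale1r.
have [|||c c01 E] := @MVT_segment R g (fun s => 'd f (x + s *: h) h) 0 1.
- exact: ler01.
- by move=> s; rewrite in_itv/= => /andP[s0 s1]; apply: gE; rewrite !ltW.
- apply: derivable_within_continuous => s; rewrite in_itv/= => s01.
  by apply/derivable1_diffP; exact: gD.
exists c; first by move: c01; rewrite in_itv.
by move: E; rewrite /g scale1r scale0r addr0 subr0 mulr1.
Qed.

Lemma diff_coordE n (f : 'cV[R]_n -> R) (x h : 'cV[R]_n) :
  differentiable f x -> 'd f x h = \sum_i dcoord i f x * h i 0.
Proof.
move=> df; rewrite [in LHS](matrix_sum_delta h) linear_sum; apply: eq_bigr => i _.
by rewrite big_ord1 linearZ/= /dcoord deriveE// mulrC.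
Qed.

(** K is fixed before the radius and every small radius is allowed, so that several such bounds can
    be combined on one ball. *)
Definition loc_lipschitz (U W : normedModType R) (F : U -> W) (q : U) :=
  exists K : R, 0 <= K /\ \forall d \near (0 : R)^'+, forall x y,
    `|x - q| <= d -> `|y - q| <= d -> `|F x - F y| <= K * `|x - y|.

Lemma C1_loc_lipschitz n (f : 'cV[R]_n -> R) q :
  Cdiff 1 f -> loc_lipschitz f q.
Proof.
move=> [df cf].
(* By continuity each partial derivative stays within 1 of its value at q. *)
exists (\sum_i (`|dcoord i f q| + 1)); split.
  by apply: sumr_ge0 => i _; rewrite addr_ge0.
have : \forall x \near q, forall i, `|dcoord i f x| <= `|dcoord i f q| + 1.
  near=> x; near: x; apply: filter_forall => i.
  have /cvgrPdist_le /(_ 1 ltr01) := cf i q.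
  apply: filterS => x h; rewrite -lerBlDl (le_trans _ h)// distrC.
  exact: lerB_dist.
move=> /nbhs_ballP[d/= d0 hd]; near=> r => x y xr yr.
have xyE : x = y + (x - y) by rewrite addrC subrK.
have [c c01 E] := @segment_mvt _ f y (x - y) (fun s _ => df _).
rewrite {1}xyE E diff_coordE// (le_trans (ler_norm_sum _ _ _))// mulr_suml.
apply: ler_sum => i _; rewrite normrM; apply: ler_pM => //; last exact: mx_entry_le.
apply: hd; rewrite -ball_normE/= -normrN opprB.
(* Convexity: the segment from y to x stays in the ball around q. *)
have -> : y + c *: (x - y) - q = c *: (x - q) + (1 - c) *: (y - q).
  by apply/matrixP => k j; rewrite !mxE; ring.
rewrite (le_lt_trans (ler_normD _ _))// !normrZ.
have [c0 c1] := andP c01.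
rewrite (ger0_norm c0) ger0_norm ?subr_ge0//.
have rd : r < d by near: r; exact: nbhs_right_lt.
have : c * `|x - q| <= c * r by rewrite ler_wpM2l.
have : (1 - c) * `|y - q| <= (1 - c) * r by rewrite ler_wpM2l// subr_ge0.
lra.
Unshelve. all: by end_near. Qed.

Lemma mx_loc_lipschitz (U : normedModType R) m n (F : U -> 'M[R]_(m, n)) q :
  (forall i j, loc_lipschitz (fun x => F x i j) q) -> loc_lipschitz F q.
Proof.
move=> h; have {h}[K hK] : exists K : 'I_m -> 'I_n -> R, forall i j, 0 <= K i j /\
    \forall d \near (0 : R)^'+, forall x y, `|x - q| <= d -> `|y - q| <= d ->
      `|F x i j - F y i j| <= K i j * `|x - y|.
  by exists (fun i j => sval (cid (h i j))) => i j; exact: svalP (cid (h i j)).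
have KP : \forall d \near (0 : R)^'+, forall i j x y, `|x - q| <= d -> `|y - q| <= d ->
    `|F x i j - F y i j| <= K i j * `|x - y|.
  near=> d => i j; move: i j; near: d.
  by apply: filter_forall => /= i; apply: filter_forall => /= j; exact: (hK i j).2.
have K0 i j : 0 <= K i j := (hK i j).1.
exists (\sum_i \sum_j K i j); split; first by do 2!apply: sumr_ge0 => ? _.
apply: filterS KP => d h x y xd yd; apply: mx_norm_le => [|i j].
  by rewrite mulr_ge0//; do 2!apply: sumr_ge0 => ? _.
rewrite !mxE (le_trans (h i j _ _ xd yd))// ler_wpM2r//.
rewrite (bigD1 i)//= (bigD1 j)//= -addrA lerDl addr_ge0//.
  by apply: sumr_ge0.
by do 2!apply: sumr_ge0 => ? _.
Unshelve. all: by end_near. Qed.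

End Segment.

(** * Polynomial expansions at 0 *)

Section Order.
Context {R : realType}.

Lemma near0_norm_le (c : R) : 0 < c -> \forall t \near (0 : R), `|t| <= c.
Proof. by move=> c0; apply/nbhs_norm0P; exists c => //= t; exact: ltW. Qed.

(** The neighbourhood contains 0 itself, so a positive k forces f 0 = 0, while k = 0 is local
    boundedness. *)
Definition Opow (W : normedModType R) (k : nat) (f : R -> W) :=
  exists K : R, 0 <= K /\ \forall t \near (0 : R), `|f t| <= K * `|t| ^+ k.

Lemma Opow_le (W : normedModType R) j k (f : R -> W) :
  (j <= k)%N -> Opow k f -> Opow j f.
Proof.
move=> jk [K [K0 fK]]; exists K; split=> //; near=> t.
have fKt : `|f t| <= K * `|t| ^+ k by near: t.
apply: (le_trans fKt); rewrite ler_wpM2l// ler_wiXn2l//.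
Unshelve. all: by end_near. Qed.

Lemma eq_Opow (W : normedModType R) k (f g : R -> W) :
  f =1 g -> Opow k f -> Opow k g.
Proof. by move=> /funext ->. Qed.

Lemma Opow_0 (W : normedModType R) k : Opow k (fun=> 0 : W).
Proof.
exists 0; split=> //; near=> t; by rewrite normr0 mul0r.
Unshelve. all: by end_near. Qed.

Lemma OpowD (W : normedModType R) k (f g : R -> W) :
  Opow k f -> Opow k g -> Opow k (fun t => f t + g t).
Proof.
move=> [K [K0 fK]] [L [L0 gL]]; exists (K + L); split; first exact: addr_ge0.
near=> t; rewrite mulrDl (le_trans (ler_normD _ _))// lerD//; near: t.
Unshelve. all: by end_near. Qed.

Lemma OpowN (W : normedModType R) k (f : R -> W) :
  Opow k f -> Opow k (fun t => - f t).
Proof.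
move=> [K [K0 fK]]; exists K; split => //.
by near=> t; rewrite normrN; near: t.
Unshelve. all: by end_near. Qed.

Lemma OpowM j k (f g : R -> R) :
  Opow j f -> Opow k g -> Opow (j + k) (fun t => f t * g t).
Proof.
move=> [K [K0 fK]] [L [L0 gL]]; exists (K * L); split; first exact: mulr_ge0.
near=> t; rewrite normrM exprD mulrACA; apply: ler_pM => //; near: t.
Unshelve. all: by end_near. Qed.

Lemma continuous_Opow (W : normedModType R) (f : R -> W) :
  {for 0, continuous f} -> Opow 0 f.
Proof.
move=> cf; exists (`|f 0| + 1); split; first exact: addr_ge0.
have /cvgrPdist_le /(_ 1 ltr01) := cf.
apply: filterS => t h; rewrite expr0 mulr1 -lerBlDl (le_trans _ h)// distrC.
exact: lerB_dist.
Qed.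

Lemma near_mul_le (A c : R) : 0 <= A -> 0 < c ->
  \forall t \near (0 : R)^'+, t * A <= c.
Proof.
move=> A0 c0; near=> t; apply: (@le_trans _ _ (t * (A + 1))).
  by rewrite ler_wpM2l ?lerDl//; near: t; exact: nbhs_right_ge.
rewrite -ler_pdivlMr ?ltr_wpDl//; near: t; apply: nbhs_right_le.
by rewrite divr_gt0 ?ltr_wpDl.
Unshelve. all: by end_near. Qed.

Lemma Opow_half (W : normedModType R) k (f : R -> W) :
  Opow k f -> Opow k (fun t => f (t / 2)).
Proof.
move=> [K [K0 /nbhs_norm0P[d/= d0 hd]]]; exists K; split=> //.
apply/nbhs_norm0P; exists d => //= t td.
have t2 : `|t / 2| <= `|t|.
  by rewrite normrM normfV [`|2|]ger0_norm//; have := normr_ge0 t; lra.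
apply: (le_trans (hd _ (le_lt_trans t2 td))).
by rewrite ler_wpM2l// lerXn2r// nnegrE.
Qed.

Lemma Opow_right (W : normedModType R) k (f : R -> W) : Opow k f ->
  exists K : R, 0 <= K /\ \forall t \near (0 : R)^'+, `|f t| <= K * t ^+ k.
Proof.
move=> [K [K0 hK]]; exists K; split=> //; near=> t.
have t0 : 0 <= t by near: t; exact: nbhs_right_ge.
rewrite -{2}(ger0_norm t0); near: t.
exact: (cvg_at_right_filter cvg_id).
Unshelve. all: by end_near. Qed.

Lemma Opow_small (W : normedModType R) k (f : R -> W) (c : R) : Opow k.+1 f ->
  0 < c -> \forall t \near (0 : R)^'+, `|f t| <= c.
Proof.
move=> /(Opow_le (isT : (1 <= k.+1)%N))/Opow_right[K [K0 hK]] c0; near=> t.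
have : `|f t| <= K * t ^+ 1 by near: t.
move=> /le_trans; apply; rewrite expr1 mulrC; near: t; exact: near_mul_le.
Unshelve. all: by end_near. Qed.

(** The mean value theorem replaces integration: the increment of F is t times a value of G between
    0 and t. *)
Lemma Opow_integral k (F G : R -> R) :
  (\forall t \near (0 : R), is_derive (t : R) (1 : R) F (G t)) -> Opow k G ->
  Opow k.+1 (fun t => F t - F 0).
Proof.
move=> FG [K [K0 GK]]; exists K; split=> //.
have : \forall t \near (0 : R), is_derive (t : R) (1 : R) F (G t) /\ `|G t| <= K * `|t| ^+ k.
  by apply: filterS2 FG GK.
move=> /nbhs_norm0P[d/= d0 hd].
apply/nbhs_norm0P; exists d => //= t td.
have lt (s : R) : 0 <= s <= 1 -> `|0 + s *: t| < d.
  move=> /andP[s0 s1]; rewrite add0r normrZ ger0_norm//.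
  by rewrite (le_lt_trans _ td)// ler_piMl.
have dF (s : R) : 0 <= s <= 1 -> differentiable F (0 + s *: t).
  move=> s01; have [/= [Fs _] _] := hd _ (lt s s01).
  exact/derivable1_diffP.
have [c c01] := segment_mvt dF; rewrite add0r => ->.
have [/= FGc GKc] := hd _ (lt c c01).
rewrite -[X in 'd _ _ X]mulr1 [X in 'd _ _ X](_ : _ = t *: 1)// linearZ/=.
rewrite -deriveE; last exact: dF.
rewrite derive_val normrM exprS mulrCA ler_wpM2l// (le_trans GKc)//.
rewrite ler_wpM2l// lerXn2r ?nnegrE//.
rewrite add0r normrZ ler_piMl//; case/andP: c01 => c0 c1.
by rewrite ger0_norm.
Qed.

Lemma horner_Opow (p : {poly R}) : Opow 0 (fun t => p.[t]).
Proof. by apply: continuous_Opow; exact: continuous_horner. Qed.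

(* The degree of [p] is not bounded by [k], so that [tay k] is closed under
   products and antiderivatives without truncation. *)
Definition tay (k : nat) (f : R -> R) :=
  exists p : {poly R}, Opow k (fun t => f t - p.[t]).

Lemma eq_tay k (f g : R -> R) : f =1 g -> tay k f -> tay k g.
Proof. by move=> /funext ->. Qed.

Lemma tay_le j k f : (j <= k)%N -> tay k f -> tay j f.
Proof. by move=> jk [p hp]; exists p; exact: Opow_le hp. Qed.

Lemma tay_cst k c : tay k (fun=> c).
Proof.
exists c%:P; apply: eq_Opow (Opow_0 _ k) => t /=.
by rewrite hornerC subrr.
Qed.

Lemma tay0P f : tay 0 f <-> Opow 0 f.
Proof.
split=> [[p hp]|hf].
  by apply: eq_Opow (OpowD hp (horner_Opow p)) => t /=; rewrite subrK.
by exists 0; apply: eq_Opow hf => t; rewrite horner0 subr0.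
Qed.

Lemma tayD k f g : tay k f -> tay k g -> tay k (fun t => f t + g t).
Proof.
move=> [p hp] [r hr]; exists (p + r).
by apply: eq_Opow (OpowD hp hr) => t; rewrite hornerD; ring.
Qed.

Lemma tayN k f : tay k f -> tay k (fun t => - f t).
Proof.
move=> [p hp]; exists (- p).
by apply: eq_Opow (OpowN hp) => t; rewrite hornerN; ring.
Qed.

Lemma tayM k f g : tay k f -> tay k g -> tay k (fun t => f t * g t).
Proof.
move=> [p hp] [r hr]; exists (p * r).
have hf : Opow 0 f by apply/tay0P; apply: (@tay_le _ k) => //; exists p.
have := OpowD (OpowM hf hr) (OpowM (horner_Opow r) hp).
by apply: eq_Opow => t; rewrite hornerM; ring.
Qed.

Lemma tay_sum k (I : Type) (s : seq I) (P : pred I) (f : I -> R -> R) :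
  (forall i, tay k (f i)) -> tay k (fun t => \sum_(i <- s | P i) f i t).
Proof.
move=> hf; elim: s => [|i s ih].
  by apply: eq_tay (tay_cst k 0) => t; rewrite big_nil.
case Pi : (P i); last by apply: eq_tay ih => t; rewrite big_cons Pi.
by apply: eq_tay (tayD (hf i) ih) => t; rewrite big_cons Pi.
Qed.

Lemma tay_prod k (I : Type) (s : seq I) (P : pred I) (f : I -> R -> R) :
  (forall i, tay k (f i)) -> tay k (fun t => \prod_(i <- s | P i) f i t).
Proof.
move=> hf; elim: s => [|i s ih].
  by apply: eq_tay (tay_cst k 1) => t; rewrite big_nil.
case Pi : (P i); last by apply: eq_tay ih => t; rewrite big_cons Pi.
by apply: eq_tay (tayM (hf i) ih) => t; rewrite big_cons Pi.
Qed.

Lemma Opow_at0 k (f : R -> R) : Opow k.+1 f -> f 0 = 0.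
Proof.
move=> [K [_ /nbhs_singleton]].
by rewrite normr0 expr0n/= mulr0 normr_le0 => /eqP.
Qed.

Lemma tay_horner0 k f p :
  Opow k.+1 (fun t => f t - p.[t]) -> f 0 = p.[0].
Proof. by move=> /Opow_at0/eqP; rewrite subr_eq0 => /eqP. Qed.

(* Newton's iteration [r <- r (2 - p r)] squares the error of an approximate inverse. *)
Lemma tayV k f : tay k.+1 f -> f 0 != 0 -> tay k.+1 (fun t => (f t)^-1).
Proof.
move=> [p hp] f0; have p0 : p.[0] = f 0 by rewrite (tay_horner0 hp).
have [r hr] : exists r : {poly R}, Opow k.+1 (fun t => p.[t] * r.[t] - 1).
  elim: k {hp} => [|k [r hr]].
    exists ((f 0)^-1)%:P.
    have e0 : p.[0] * (f 0)^-1 - 1 = 0 by rewrite p0 divff// subrr.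
    have : Opow 1 (fun t => (p * (f 0)^-1%:P).[t] - (p * (f 0)^-1%:P).[0]).
      apply: (@Opow_integral 0 _ (fun t => (p * (f 0)^-1%:P)^`().[t])).
        by near=> t; exact: is_derive_poly.
      exact: horner_Opow.
    apply: eq_Opow => t; rewrite !hornerM !hornerC.
    by move/eqP: e0; rewrite subr_eq0 => /eqP ->.
  (* p r (2 - p r) - 1 = - (p r - 1)^2 has order 2 (k + 1), which is at least k + 2. *)
  exists (r * (2%:P - p * r)).
  have := Opow_le _ (OpowN (OpowM hr hr)).
  move=> /(_ k.+2); rewrite addSn ltnS leq_addl => /(_ isT).
  by apply: eq_Opow => t; rewrite !(hornerM, hornerD, hornerN, hornerC); ring.
exists r.
have cf : \forall t \near (0 : R), `|f 0| / 2 <= `|f t|.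
  have [K [K0 hK]] := Opow_le (isT : (1 <= k.+1)%N) hp.
  have cp : \forall t \near (0 : R), `|p.[0] - p.[t]| <= `|f 0| / 4.
    have /cvgrPdist_le := @continuous_horner _ p 0; apply.
    by rewrite divr_gt0 ?normr_gt0.
  near=> t.
  have h1 : `|f t - p.[t]| <= K * `|t| ^+ 1 by near: t.
  have h2 : `|p.[0] - p.[t]| <= `|f 0| / 4 by near: t.
  have h3 : K * `|t| <= `|f 0| / 4.
    apply: (@le_trans _ _ ((K + 1) * `|t|)); first by rewrite ler_wpM2r// lerDl.
    rewrite -ler_pdivlMl//; last by rewrite ltr_wpDl.
    near: t; apply: near0_norm_le.
    by rewrite mulr_gt0 ?invr_gt0 ?ltr_wpDl// divr_gt0// normr_gt0.
  rewrite expr1 in h1.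
  have : `|f 0| <= `|f t| + `|f t - p.[t]| + `|p.[0] - p.[t]|.
    rewrite -p0 (_ : p.[0] = f t - (f t - p.[t]) + (p.[0] - p.[t])); last by ring.
    rewrite (le_trans (ler_normD _ _))// lerD//.
      by rewrite (le_trans (ler_normB _ _)).
    by rewrite le_eqVlt; apply/orP; left; apply/eqP; congr `|_|; ring.
  lra.
have hV : Opow 0 (fun t => (f t)^-1).
  exists (2 / `|f 0|); split; first by rewrite divr_ge0.
  near=> t; rewrite expr0 mulr1.
  have h : `|f 0| / 2 <= `|f t| by near: t.
  rewrite normfV -[2 / _]invf_div lef_pV2// posrE ?divr_gt0 ?normr_gt0//.
  by rewrite -normr_gt0 (lt_le_trans _ h)// divr_gt0 ?normr_gt0.
have fn0 : \forall t \near (0 : R), f t != 0.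
  near=> t; have h : `|f 0| / 2 <= `|f t| by near: t.
  by rewrite -normr_gt0 (lt_le_trans _ h)// divr_gt0 ?normr_gt0.
have [K [K0 hK]] := OpowD (OpowN (OpowM hV (OpowM (horner_Opow r) hp)))
  (OpowN (OpowM hV hr)).
exists K; split=> //; near=> t.
have -> : (f t)^-1 - r.[t] = - ((f t)^-1 * (r.[t] * (f t - p.[t])))
   - (f t)^-1 * (p.[t] * r.[t] - 1).
  have ft0 : f t != 0 by near: t.
  by field.
by near: t.
Unshelve. all: by end_near. Qed.

Lemma antideriv (p : {poly R}) : exists P : {poly R}, P^`() = p.
Proof.
exists (\sum_(i < size p) (p`_i / i.+1%:R) *: 'X^(i.+1)).
rewrite linear_sum/= -[RHS]coefK poly_def.
apply: eq_bigr => i _.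
by rewrite derivZ derivXn/= -scalerMnr scalerMnl -mulr_natr divfK.
Qed.

Lemma tay_integral k (F G : R -> R) :
  (\forall t \near (0 : R), is_derive (t : R) (1 : R) F (G t)) -> tay k G -> tay k.+1 F.
Proof.
move=> FG [p hp]; have [P PE] := antideriv p.
(* The constant makes the polynomial agree with F at 0. *)
exists (P + (F 0 - P.[0])%:P).
apply: eq_Opow (Opow_integral (F := fun t => F t - P.[t]) _ hp) => [t|].
  by rewrite hornerD hornerC; ring.
near=> t; rewrite -PE.
have Ft : is_derive (t : R) (1 : R) F (G t) by near: t.
rewrite (_ : (fun t => F t - P.[t]) = F - horner P)//.
exact: is_deriveB.
Unshelve. all: by end_near. Qed.

Lemma tay1_increment f : tay 1 f -> Opow 1 (fun t => f t - f 0).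
Proof.
move=> [p hp]; have hP : Opow 1 (fun t => p.[t] - p.[0]).
  apply: (@Opow_integral 0 _ (fun t => p^`().[t])); last exact: horner_Opow.
  by near=> t; exact: is_derive_poly.
by apply: eq_Opow (OpowD hp hP) => t; rewrite (tay_horner0 hp); ring.
Unshelve. all: by end_near. Qed.

(** Since p may have any degree, its part of degree at least 2 is moved into the remainder. *)
Lemma tay2_linear f :
  tay 2 f -> exists c, Opow 2 (fun t => f t - f 0 - c * t).
Proof.
move=> [p hp]; have f0 := tay_horner0 hp.
exists p`_1.
have hd := horner_Opow (drop_poly 2 p).
have h2 : Opow 2 (fun t : R => t ^+ 2).
  by exists 1; split=> //; near=> t; rewrite mul1r normrX.
apply: eq_Opow (OpowD hp (OpowM hd h2)) => t.
have -> : p.[t] = p`_0 + p`_1 * t + (drop_poly 2 p).[t] * t ^+ 2.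
  rewrite -[in LHS](poly_take_drop 2 p) hornerD hornerM hornerXn.
  rewrite /take_poly horner_poly !big_ord_recl big_ord0/= expr0 expr1.
  by rewrite mulr1 addr0.
by rewrite f0 horner_coef0; ring.
Unshelve. all: by end_near. Qed.

(** Both rules are exact on affine integrands, and remainders of order 2 give order 3 after
    integration or multiplication by e. There are two integrands because the scheme samples the
    force at the end points and the reaction at the midpoint. *)
Lemma quadrature (F g G : R -> R) :
  (\forall t \near (0 : R), is_derive (t : R) (1 : R) F (g t + G t)) ->
  tay 2 g -> tay 2 G ->
  Opow 3 (fun e => F e - F 0 - e / 2 * (g 0 + g e) - e * G (e / 2)).
Proof.
move=> FG /tay2_linear[c hc] /tay2_linear[C hC].
have h1 : Opow 3 (fun t => (F t - (g 0 + G 0) * t - (c + C) / 2 * t ^+ 2) - F 0).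
  have := @Opow_integral 2 (fun t => F t - (g 0 + G 0) * t - (c + C) / 2 * t ^+ 2)
     (fun t => (g t - g 0 - c * t) + (G t - G 0 - C * t)).
  rewrite mulr0 expr0n/= mulr0 !subr0; apply; last exact: OpowD.
  near=> t.
  have Ft : is_derive (t : R) (1 : R) F (g t + G t) by near: t.
  pose P : {poly R} := (g 0 + G 0) *: 'X + ((c + C) / 2) *: 'X^2.
  have PE : (fun t => F t - (g 0 + G 0) * t - (c + C) / 2 * t ^+ 2) = F - horner P.
    by apply/funext => s /=; rewrite !fctE !hornerE; ring.
  rewrite PE; apply: is_derive_eq.
  have -> : P^`().[t] = g 0 + G 0 + (c + C) * t.
    rewrite /P derivD !derivZ derivX derivXn/= hornerD !hornerZ hornerC hornerMn.
    by rewrite hornerX; field.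
  by ring.
have hid : Opow 1 (fun t : R => t).
  by exists 1; split=> //; near=> t; rewrite mul1r.
have hC2 : Opow 2 (fun t => G (t / 2) - G 0 - C * (t / 2)) by exact: (Opow_half hC).
have hhalf : Opow 1 (fun t : R => t / 2).
  exists 1; split=> //; near=> t; rewrite mul1r normrM normfV.
  by rewrite [`|2|]ger0_norm//; have := normr_ge0 t; rewrite expr1; lra.
have := OpowD h1 (OpowD (OpowN (OpowM hhalf hc)) (OpowN (OpowM hid hC2))).
by apply: eq_Opow => e; field.
Unshelve. all: by end_near. Qed.

End Order.

(** * Expansions of matrix-valued functions *)

Section MatrixOrder.
Context {R : realType}.

Lemma mx_Opow k m n (F : R -> 'M[R]_(m, n)) :
  (forall i j, Opow k (fun t => F t i j)) -> Opow k F.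
Proof.
move=> h; have {h}[K hK] : exists K : 'I_m -> 'I_n -> R, forall i j, 0 <= K i j /\
    \forall t \near (0 : R), `|F t i j| <= K i j * `|t| ^+ k.
  by exists (fun i j => sval (cid (h i j))) => i j; exact: svalP (cid (h i j)).
have K0 i j : 0 <= K i j := (hK i j).1.
have KP : \forall t \near (0 : R), forall i j, `|F t i j| <= K i j * `|t| ^+ k.
  near=> d => i j; move: i j; near: d.
  by apply: filter_forall => /= i; apply: filter_forall => /= j; exact: (hK i j).2.
exists (\sum_i \sum_j K i j); split; first by do 2!apply: sumr_ge0 => ? _.
apply: filterS KP => d h; apply: mx_norm_le => [|i j].
  by rewrite mulr_ge0 ?exprn_ge0//; do 2!apply: sumr_ge0 => ? _.
rewrite (le_trans (h i j))// ler_wpM2r ?exprn_ge0//.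
rewrite (bigD1 i)//= (bigD1 j)//= -addrA lerDl addr_ge0//.
  by apply: sumr_ge0.
by do 2!apply: sumr_ge0 => ? _.
Unshelve. all: by end_near. Qed.

Definition mxtay k m n (F : R -> 'M[R]_(m, n)) :=
  forall i j, tay k (fun t => F t i j).

Lemma mxtay_le j k m n (F : R -> 'M[R]_(m, n)) :
  (j <= k)%N -> mxtay k F -> mxtay j F.
Proof. by move=> jk hF a b; exact: tay_le (hF a b). Qed.

Lemma mxtay_cst k m n (A : 'M[R]_(m, n)) : mxtay k (fun=> A).
Proof. by move=> i j; exact: tay_cst. Qed.

Lemma mxtayD k m n (F G : R -> 'M[R]_(m, n)) :
  mxtay k F -> mxtay k G -> mxtay k (fun t => F t + G t).
Proof.
by move=> hF hG i j; apply: eq_tay (tayD (hF i j) (hG i j)) => t; rewrite mxE.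
Qed.

Lemma mxtayN k m n (F : R -> 'M[R]_(m, n)) :
  mxtay k F -> mxtay k (fun t => - F t).
Proof. by move=> hF i j; apply: eq_tay (tayN (hF i j)) => t; rewrite mxE. Qed.

Lemma mxtay_tr k m n (F : R -> 'M[R]_(m, n)) :
  mxtay k F -> mxtay k (fun t => (F t)^T).
Proof. by move=> hF i j; apply: eq_tay (hF j i) => t; rewrite mxE. Qed.

Lemma mxtayM k m n p (F : R -> 'M[R]_(m, n)) (G : R -> 'M[R]_(n, p)) :
  mxtay k F -> mxtay k G -> mxtay k (fun t => F t *m G t).
Proof.
move=> hF hG i j.
have := @tay_sum _ k _ (index_enum 'I_n) predT (fun l t => F t i l * G t l j)
  (fun l => tayM (hF i l) (hG l j)).
by apply: eq_tay => t; rewrite mxE.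
Qed.

Lemma tay_det k n (F : R -> 'M[R]_n) : mxtay k F -> tay k (fun t => \det (F t)).
Proof.
move=> hF; rewrite /determinant; apply: tay_sum => s.
have hp : tay k (fun t => \prod_i F t i (s i)).
  by apply: (@tay_prod _ k _ _ _ (fun i t => F t i (s i))) => i; exact: hF.
exact: (tayM (tay_cst k ((-1 : R) ^+ odd_perm s)) hp).
Qed.

(** Cramer's rule reduces the inverse to determinants and one scalar inverse. The order is positive
    because mere local boundedness would not keep the determinant away from 0. *)
Lemma mxtay_inv k n (F : R -> 'M[R]_n) :
  (forall t, F t \in unitmx) -> mxtay k.+1 F -> mxtay k.+1 (fun t => invmx (F t)).
Proof.
move=> uF hF i j.
have hdet : tay k.+1 (fun t => (\det (F t))^-1).
  by apply: tayV; [exact: tay_det | rewrite -unitfE -unitmxE].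
have hadj : tay k.+1 (fun t => (\adj (F t)) i j).
  apply: (@eq_tay _ _ (fun t => (-1) ^+ (j + i) * \det (row' j (col' i (F t))))).
    by move=> t; rewrite mxE.
  apply: tayM; first exact: tay_cst.
  apply: tay_det => a b.
  by apply: eq_tay (hF (lift j a) (lift i b)) => t; rewrite !mxE.
by apply: eq_tay (tayM hdet hadj) => t; rewrite /invmx uF [RHS]mxE.
Qed.

End MatrixOrder.

(** * Expansions along curves *)

Section Curves.
Context {R : realType} {n : nat}.
Implicit Types q v : R -> 'cV[R]_n.

(** Difference quotients at a point of differentiability are bounded. This starts the bootstrap for
    the velocity. *)
Lemma derivable_tay1 (f : R -> R) : derivable f 0 1 -> tay 1 f.
Proof.
move=> df; exists (f 0)%:P.
have [K [K0 hK]] : exists K : R, 0 <= K /\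
    \forall h \near (0 : R)^', `|h^-1 *: (f (h *: 1 + 0) - f 0)| <= K.
  exists (`|'D_1 f 0| + 1); split; first exact: addr_ge0.
  have /cvgrPdist_le /(_ 1 ltr01) := df.
  apply: filterS => t h; rewrite -lerBlDl (le_trans _ h)// distrC.
  exact: lerB_dist.
exists K; split=> //.
have : \forall h \near (0 : R), h != 0 -> `|h^-1 *: (f (h *: 1 + 0) - f 0)| <= K.
  exact: hK.
apply: filterS => h; rewrite hornerC expr1.
have [->|h0 /(_ isT)] := eqVneq h 0; first by rewrite subrr normr0 mulr0.
by rewrite addr0 [_ *: 1]mulr1 normrM normfV mulrC ler_pdivrMr ?normr_gt0.
Qed.

Lemma is_derive_entry m (F : R -> 'M[R]_(m, n)) dF t i j :
  is_derive t (1 : R) F dF -> is_derive t (1 : R) (fun s => F s i j) (dF i j).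
Proof.
move=> [Fd FE]; have /derivable_mxP dFij := Fd.
by apply: DeriveDef => //; rewrite -FE derive_mx// mxE.
Qed.

Lemma is_derive_comp_curve (f : 'cV[R]_n -> R) q v t :
  (forall x, differentiable f x) -> is_derive t (1 : R) q (v t) ->
  is_derive t (1 : R) (f \o q) (\sum_i dcoord i f (q t) * v t i 0).
Proof.
move=> df [dq qE]; have {}dq := (derivable1_diffP q t).1 dq.
have dfq : differentiable (f \o q) t by exact: differentiable_comp.
apply: DeriveDef; first exact/derivable1_diffP.
by rewrite deriveE// diff_comp//= -(deriveE _ dq) qE diff_coordE.
Qed.

(** Induction on the order for all smooth f at once: the derivative along q involves the partial
    derivatives of f, which must be expanded along q too. At order 1 their continuity suffices. *)
Lemma tay_smooth_comp k (f : 'cV[R]_n -> R) q v :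
  (\forall t \near (0 : R), is_derive t (1 : R) q (v t)) ->
  mxtay k v -> smooth f -> tay k.+1 (f \o q).
Proof.
move=> qv; elim: k f => [|k ih] f hv sf; have [df _] := sf 1%N;
  apply: (@tay_integral _ _ _ (fun t => \sum_i dcoord i f (q t) * v t i 0)).
- by near=> t; apply: is_derive_comp_curve => //; near: t.
- apply: tay_sum => i; apply: tayM => //; apply/tay0P.
  apply: (@continuous_Opow _ _ (dcoord i f \o q)); apply: continuous_comp.
    apply/differentiable_continuous/derivable1_diffP.
    by have [] : is_derive 0 (1 : R) q (v 0) by exact: nbhs_singleton qv.
  by have [_ /(_ i)] := sf 1%N; apply.
- by near=> t; apply: is_derive_comp_curve => //; near: t.
- apply: tay_sum => i; apply: tayM => //; apply: ih => [|l].
    exact: mxtay_le hv.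
  by have [_ /(_ i)] := sf l.+1.
Unshelve. all: by end_near. Qed.

End Curves.

(** * The exact solution *)

Section Flow.
Context {R : realType} {n m : nat}.
Variables (M : 'M[R]_n) (V : 'cV[R]_n -> R) (mu : 'cV[R]_n -> 'M[R]_(m, n)).
Hypothesis M_posdef : sym_posdef M.
Hypothesis V_smooth : smooth V.
Hypothesis mu_smooth : forall (a : 'I_m) (i : 'I_n), smooth (fun q => mu q a i).
Hypothesis mu_free : forall q, row_free (mu q).

Lemma posdef_unitmx : M \in unitmx.
Proof.
rewrite -row_free_unit; apply: inj_row_free => x xM.
apply/eqP/negPn/negP => x0; have [_ /(_ x^T)] := M_posdef.
by rewrite trmxK xM mul0mx mxE ltxx -trmx0 (inj_eq trmx_inj) x0 => /(_ isT).
Qed.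

(** If x annihilates the Gram matrix, then y = M^-1 (x mu)^T has y^T M y = 0. Positivity gives y =
    0, hence x mu = 0, and independence of the forms gives x = 0. *)
Lemma Cup_unitmx q : Cup M mu q \in unitmx.
Proof.
have [MT Mpos] := M_posdef; have uM := posdef_unitmx.
rewrite -row_free_unit; apply: inj_row_free => x; rewrite /Cup => xC.
pose y := invmx M *m (x *m mu q)^T.
have yMy : y^T *m M *m y = 0.
  rewrite /y trmx_mul trmxK trmx_inv MT -!mulmxA mulKVmx// (mulmxA x).
  by rewrite trmx_mul !mulmxA -(mulmxA x) -(mulmxA x) xC mul0mx.
have y0 : y = 0.
  by apply/eqP/negPn/negP => /Mpos; rewrite yMy mxE ltxx.
have : x *m mu q = 0.
  have : M *m y = 0 by rewrite y0 mulmx0.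
  by rewrite /y mulKVmx// => /(congr1 trmx); rewrite trmxK trmx0.
by rewrite -(mul0mx _ (mu q)) => /(row_free_inj (mu_free q)).
Qed.

Lemma smooth_dcoord (f : 'cV[R]_n -> R) i : smooth f -> smooth (dcoord i f).
Proof. by move=> sf k; have [_ /(_ i)] := sf k.+1. Qed.

Lemma grad_lipschitz q : loc_lipschitz (grad V) q.
Proof.
apply: mx_loc_lipschitz => i j.
have := C1_loc_lipschitz q (smooth_dcoord i V_smooth 1).
by congr loc_lipschitz; apply/funext => x; rewrite mxE.
Qed.

Lemma mu_lipschitz q : loc_lipschitz mu q.
Proof. by apply: mx_loc_lipschitz => i j; exact: C1_loc_lipschitz (mu_smooth i j 1). Qed.

(** The equation is autonomous, so it is enough to expand solutions at time 0. *)
Lemma flow_solution_shift t0 q v : flow_solution M V mu t0 q v ->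
  flow_solution M V mu 0 (fun t => q (t0 + t)) (fun t => v (t0 + t)).
Proof.
have shift (f : R -> 'cV[R]_n) t df : is_derive (t0 + t) (1 : R) f df ->
    is_derive t (1 : R) (fun s => f (t0 + s)) df.
  have E : (fun h : R => h^-1 *: (((fun s => f (t0 + s)) \o shift t) (h *: 1) - f (t0 + t))) =
     (fun h : R => h^-1 *: ((f \o shift (t0 + t)) (h *: 1) - f (t0 + t))).
    by apply/funext => h /=; rewrite addrCA.
  by move=> [fd fE]; apply: DeriveDef; [rewrite /derivable E|rewrite /derive E].
move=> /nbhs0P; apply: filterS => t [h1 h2 h3].
by split=> //; exact: shift.
Qed.

Section Solution.
Variables (q v : R -> 'cV[R]_n).
Hypothesis qv : flow_solution M V mu 0 q v.

Let q_derive : \forall t \near (0 : R), is_derive t (1 : R) q (v t).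
Proof. by apply: filterS qv => t []. Qed.

Let v_derive :
  \forall t \near (0 : R), is_derive t (1 : R) v (accel M V mu (q t) (v t)).
Proof. by apply: filterS qv => t []. Qed.

Lemma grad_tay k : mxtay k v -> mxtay k.+1 (fun t => grad V (q t)).
Proof.
move=> hv i j.
have := tay_smooth_comp q_derive hv (smooth_dcoord i V_smooth).
by apply: eq_tay => t /=; rewrite mxE.
Qed.

Lemma mu_tay k : mxtay k v -> mxtay k.+1 (fun t => mu (q t)).
Proof. by move=> hv i j; exact: tay_smooth_comp q_derive hv (mu_smooth i j). Qed.

(** The velocity itself enters, quadratically through [dmu_vv], so unlike for functions of the
    position no order is gained. *)
Lemma lambda_tay k : mxtay k.+1 v -> mxtay k.+1 (fun t => lambda M V mu (q t) (v t)).
Proof.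
move=> hv; have hmu := mxtay_le (leqnSn _) (mu_tay hv).
have hgrad := mxtay_le (leqnSn _) (grad_tay hv).
apply: mxtayN; apply: mxtayM.
  apply: mxtay_inv => [t|]; first exact: Cup_unitmx.
  by apply: mxtayM; [apply: mxtayM => //; exact: mxtay_cst | exact: mxtay_tr].
apply: mxtayD; last first.
  by apply: mxtayN; apply: mxtayM => //; apply: mxtayM => //; exact: mxtay_cst.
move=> b j.
have hd i l : tay k.+1 (fun t => dcoord l (fun x => mu x b i) (q t)).
  apply: (tay_le (leqnSn _)).
  exact: tay_smooth_comp q_derive hv (smooth_dcoord l (mu_smooth b i)).
have := @tay_sum _ k.+1 _ (index_enum 'I_n) predT _ (fun i =>
  @tay_sum _ k.+1 _ (index_enum 'I_n) predT _ (fun l =>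
    tayM (tayM (hd i l) (hv i 0)) (hv l 0))).
by apply: eq_tay => t; rewrite mxE.
Qed.

Lemma accel_tay k : mxtay k.+1 v -> mxtay k.+1 (fun t => accel M V mu (q t) (v t)).
Proof.
move=> hv; have hmu := mxtay_le (leqnSn _) (mu_tay hv).
have hgrad := mxtay_le (leqnSn _) (grad_tay hv).
apply: mxtayD.
  by apply: mxtayN; apply: mxtayM => //; exact: mxtay_cst.
apply: mxtayM; last exact: lambda_tay.
by apply: mxtayM; [exact: mxtay_cst | exact: mxtay_tr].
Qed.

Lemma velocity_tay k : mxtay k v.
Proof.
(* The bootstrap runs over positive orders only, as the inverse in [lambda] requires. *)
suff h : forall k, mxtay k.+1 v by exact: mxtay_le (leqnSn k) (h k).
elim=> {k}[|k ih] i j.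
  apply: derivable_tay1.
  by have [] := is_derive_entry i j (nbhs_singleton v_derive).
apply: tay_integral (accel_tay ih i j).
by apply: filterS v_derive => t /is_derive_entry.
Qed.

Lemma position_increment : Opow 1 (fun t => q t - q 0).
Proof.
apply: mx_Opow => i j.
have : tay 1 (fun t => q t i j).
  apply: tay_integral (velocity_tay 0 i j).
  by apply: filterS q_derive => t /is_derive_entry.
by move=> /tay1_increment; apply: eq_Opow => t; rewrite !mxE.
Qed.

Lemma lambda_increment :
  Opow 1 (fun t => lambda M V mu (q t) (v t) - lambda M V mu (q 0) (v 0)).
Proof.
apply: mx_Opow => i j; have := tay1_increment (lambda_tay (velocity_tay 1) i j).
have mxBE (A B : 'cV[R]_m) : A i j - B i j = (A - B) i j by rewrite !mxE.
by apply: eq_Opow => t; exact: mxBE.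
Qed.

Lemma position_quadrature :
  Opow 3 (fun e => q e - q 0 - (e / 2) *: (v 0 + v e)).
Proof.
apply: mx_Opow => i j.
(* A zero midpoint integrand leaves the plain trapezoidal rule. *)
have h := @quadrature _ (fun t => q t i j) (fun t => v t i j) (fun=> 0).
have : Opow 3 (fun e => q e i j - q 0 i j - e / 2 * (v 0 i j + v e i j) - e * 0).
  apply: h; [|exact: velocity_tay|exact: tay_cst].
  by apply: filterS q_derive => t /is_derive_entry; rewrite addr0.
by apply: eq_Opow => e; rewrite !mxE; ring.
Qed.

Lemma velocity_quadrature :
  Opow 3 (fun e => v e - v 0 + (e / 2) *: (invmx M *m (grad V (q 0) + grad V (q e)))
    - e *: (invmx M *m (mu (q (e / 2)))^T *m lambda M V mu (q (e / 2)) (v (e / 2)))).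
Proof.
pose g t := - (invmx M *m grad V (q t)).
pose G t := invmx M *m (mu (q t))^T *m lambda M V mu (q t) (v t).
have hg : mxtay 2 g.
  apply: mxtayN; apply: mxtayM; first exact: mxtay_cst.
  exact/grad_tay/velocity_tay.
have hG : mxtay 2 G.
  apply: mxtayM; last exact/lambda_tay/velocity_tay.
  by apply: mxtayM; [exact: mxtay_cst | exact/mxtay_tr/mu_tay/velocity_tay].
apply: mx_Opow => i j.
have : Opow 3 (fun e => v e i j - v 0 i j - e / 2 * (g 0 i j + g e i j) - e * G (e / 2) i j).
  apply: (@quadrature _ (fun t => v t i j) (fun t => g t i j) (fun t => G t i j)) => //.
  apply: filterS v_derive => t /is_derive_entry => /(_ i j).
  by rewrite /accel -/(g t) -/(G t) [(g t + G t) i j]mxE.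
apply: eq_Opow => e; rewrite mulmxDr /g /G !mxE; ring.
Qed.

(** Applied at e / 2, this compares the exact midpoint position with the half step of the scheme.
    Order 2 is enough there, since the reaction force carries a further factor e. *)
Lemma position_linear : Opow 2 (fun e => q e - q 0 - e *: v 0).
Proof.
apply: mx_Opow => i j.
pose P : {poly R} := v 0 i j *: 'X.
have hP t : P.[t] = v 0 i j * t by rewrite /P !hornerE.
have : Opow 2 (fun t => (q t i j - P.[t]) - (q 0 i j - P.[0])).
  apply: (@Opow_integral _ 1 _ (fun t => v t i j - v 0 i j)).
    near=> t.
    have qt : is_derive t (1 : R) q (v t) by near: t.
    have qij := is_derive_entry i j qt.
    rewrite (_ : (fun t => q t i j - P.[t]) = (fun t => q t i j) - horner P)//.
    apply: is_derive_eq.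
    by rewrite /P derivZ derivX hornerZ hornerC mulr1.
  by have := tay1_increment (velocity_tay 1 i j).
by apply: eq_Opow => t; rewrite !hP !mxE; ring.
Unshelve. all: by end_near. Qed.

End Solution.
End Flow.

(** * Bounds near a point *)

Section Bounds.
Context {R : realType}.

(** Write l = A0^-1 (A l) - A0^-1 ((A - A0) l). For A close to A0 the last term is at most |l| / 2
    and is absorbed, which doubles the constant of A0. *)
Lemma unitmx_perturb m (A0 : 'M[R]_m) : A0 \in unitmx ->
  exists c : R, 0 <= c /\ \forall d \near (0 : R)^'+, forall A, `|A - A0| <= d ->
    forall l : 'cV[R]_m, `|l| <= c * `|A *m l|.
Proof.
move=> uA0; pose a := m%:R * `|invmx A0|.
have a0 : 0 <= a by rewrite mulr_ge0.
exists (2 * a); split; first by rewrite mulr_ge0.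
near=> d => A Ad l.
have lE : l = invmx A0 *m (A *m l) - invmx A0 *m ((A - A0) *m l).
  by rewrite -mulmxBr -mulmxBl opprB addrC subrK mulKmx.
have h1 : `|invmx A0 *m (A *m l)| <= a * `|A *m l| := mulmx_norm_le _ _.
have h2 : `|invmx A0 *m ((A - A0) *m l)| <= a * (m%:R * d * `|l|).
  rewrite (le_trans (mulmx_norm_le _ _))// ler_wpM2l//.
  by rewrite (le_trans (mulmx_norm_le _ _))// ler_wpM2r// ler_wpM2l.
have h3 : a * m%:R * d <= 2^-1.
  rewrite mulrC; near: d; apply: near_mul_le; first by rewrite mulr_ge0.
  by rewrite invr_gt0.
have : `|l| <= `|invmx A0 *m (A *m l)| + `|invmx A0 *m ((A - A0) *m l)|.
  by rewrite {1}lE (le_trans (ler_normB _ _)).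
have : a * (m%:R * d * `|l|) <= 2^-1 * `|l| by rewrite !mulrA ler_wpM2r.
lra.
Unshelve. all: by end_near. Qed.

End Bounds.

Section LocalBounds.
Context {R : realType} {n m : nat}.
Variables (M : 'M[R]_n) (V : 'cV[R]_n -> R) (mu : 'cV[R]_n -> 'M[R]_(m, n)).

(** One constant for every estimate used in the error bound and in the existence proof.
    [gram_coercive] has two points because the constraint is imposed at the end of the step and the
    reaction acts at its midpoint. *)
Record step_bounds (K : R) (x y : 'cV[R]_n) : Prop := StepBounds {
  force_le : `|invmx M *m grad V x| <= K;
  force_lip : `|invmx M *m (grad V x - grad V y)| <= K * `|x - y|;
  form_le : forall a : 'cV[R]_n, `|mu x *m a| <= K * `|a|;
  form_lip : forall a : 'cV[R]_n, `|(mu x - mu y) *m a| <= K * `|x - y| * `|a|;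
  reaction_le : forall l : 'cV[R]_m, `|invmx M *m (mu x)^T *m l| <= K * `|l|;
  reaction_lip : forall l : 'cV[R]_m,
    `|invmx M *m (mu x - mu y)^T *m l| <= K * `|x - y| * `|l|;
  gram_coercive : forall l : 'cV[R]_m,
    `|l| <= K * `|mu x *m (invmx M *m (mu y)^T *m l)| }.

Hypothesis M_posdef : sym_posdef M.
Hypothesis V_smooth : smooth V.
Hypothesis mu_smooth : forall (a : 'I_m) (i : 'I_n), smooth (fun q => mu q a i).
Hypothesis mu_free : forall q, row_free (mu q).

Lemma local_step_bounds q0 : exists K : R, 1 <= K /\ \forall d \near (0 : R)^'+,
  forall x y, `|x - q0| <= d -> `|y - q0| <= d -> step_bounds K x y.
Proof.
have [KV [KV0 hV]] := grad_lipschitz V_smooth q0.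
have [Km [Km0 hm]] := mu_lipschitz mu_smooth q0.
have [c [c0 hc]] := unitmx_perturb (Cup_unitmx M_posdef mu_free q0).
pose N := invmx M; pose nN := n%:R * `|N|.
have nN0 : 0 <= nN by rewrite mulr_ge0.
pose B := `|mu q0| + Km.
have B0 : 0 <= B by rewrite addr_ge0.
pose K1 := nN * (`|grad V q0| + KV).
pose K2 := nN * KV.
pose K3 := n%:R * B.
pose K4 := n%:R * Km.
pose K5 := m%:R * (nN * B).
pose K6 := m%:R * (nN * Km).
have K10 : 0 <= K1 by rewrite mulr_ge0 ?addr_ge0.
have K20 : 0 <= K2 by rewrite mulr_ge0.
have K30 : 0 <= K3 by rewrite mulr_ge0.
have K40 : 0 <= K4 by rewrite mulr_ge0.
have K50 : 0 <= K5 by rewrite !mulr_ge0.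
have K60 : 0 <= K6 by rewrite !mulr_ge0.
(* C d bounds the distance from [Cup M mu q0] to a mixed Gram matrix with both points within d of
   q0. The radius e of coercivity is fixed first, then d with C d <= e. *)
pose C := n%:R * Km * (nN * B) + n%:R * `|mu q0| * (nN * Km).
have C0 : 0 <= C by rewrite addr_ge0// !mulr_ge0.
have /filter_ex[e [e0 he]] : \forall e \near (0 : R)^'+, 0 < e /\
    forall A : 'M[R]_m, `|A - Cup M mu q0| <= e -> forall l : 'cV[R]_m, `|l| <= c * `|A *m l|.
  by near=> e; split; near: e; [exact: nbhs_right_gt|exact: hc].
exists (1 + K1 + K2 + K3 + K4 + K5 + K6 + c); split; first by lra.
near=> d => x y xd yd.
have d0 : 0 <= d by near: d; exact: nbhs_right_ge.
have d1 : d <= 1 by near: d; exact: nbhs_right_le.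
have Cd : C * d <= e by rewrite mulrC; near: d; exact: near_mul_le.
have hVd : forall x y, `|x - q0| <= d -> `|y - q0| <= d ->
  `|grad V x - grad V y| <= KV * `|x - y| by near: d.
have hmd : forall x y, `|x - q0| <= d -> `|y - q0| <= d ->
  `|mu x - mu y| <= Km * `|x - y| by near: d.
have q0d : `|q0 - q0| <= d by rewrite subrr normr0.
have mxd z : `|z - q0| <= d -> `|mu z - mu q0| <= Km * d.
  by move=> zd; rewrite (le_trans (hmd _ _ zd q0d))// ler_wpM2l.
have mxB z : `|z - q0| <= d -> `|mu z| <= B.
  move=> zd; rewrite -[mu z](subrK (mu q0)) (le_trans (ler_normD _ _))//.
  rewrite addrC lerD2l (le_trans (mxd _ zd))//.
  by rewrite -[leRHS]mulr1 ler_wpM2l.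
have NmT (z : 'M[R]_(m, n)) z1 : `|z| <= z1 -> `|N *m z^T| <= nN * z1.
  by move=> zz1; apply: mulmx_le => //; rewrite trmx_norm.
have gV z : `|z - q0| <= d -> `|grad V z| <= `|grad V q0| + KV.
  move=> zd; rewrite -[grad V z](subrK (grad V q0)) (le_trans (ler_normD _ _))//.
  rewrite addrC lerD2l (le_trans (hVd _ _ zd q0d))//.
  by rewrite -[leRHS]mulr1 ler_wpM2l// (le_trans zd).
have le_K (K' t s : R) : 0 <= t -> s <= K' * t -> K' <= 1 + K1 + K2 + K3 + K4 + K5 + K6 + c ->
   s <= (1 + K1 + K2 + K3 + K4 + K5 + K6 + c) * t.
  by move=> t0 sK KK; rewrite (le_trans sK)// ler_wpM2r.
split.
- have h : `|N *m grad V x| <= K1 by apply: mulmx_le => //; exact: gV.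
  by rewrite (le_trans h)//; lra.
- apply: (le_K K2) => //; last by lra.
  by rewrite /K2 -mulrA; apply: mulmx_le => //; exact: hVd.
- move=> a; apply: (le_K K3) => //; last by lra.
  by apply: mulmx_le => //; exact: mxB.
- move=> a; rewrite -mulrA; apply: (le_K K4); [by rewrite mulr_ge0| |lra].
  rewrite /K4 mulrA -[_ * Km * _]mulrA; apply: mulmx_le => //; exact: hmd.
- move=> l; apply: (le_K K5) => //; last by lra.
  by apply: mulmx_le => //; apply: NmT; exact: mxB.
- move=> l; rewrite -mulrA; apply: (le_K K6); [by rewrite mulr_ge0| |lra].
  have -> : K6 * (`|x - y| * `|l|) = m%:R * (nN * (Km * `|x - y|)) * `|l|.
    by rewrite /K6; ring.
  by apply: mulmx_le => //; apply: NmT; exact: hmd.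
- move=> l; apply: (le_K c) => //; last by lra.
  rewrite mulmxA; apply: he; apply: le_trans Cd.
  have -> : mu x *m (N *m (mu y)^T) - Cup M mu q0 =
      (mu x - mu q0) *m (N *m (mu y)^T) + mu q0 *m (N *m (mu y - mu q0)^T).
    by rewrite /Cup -/N -mulmxA raddfB/= !mulmxBr mulmxBl addrA subrK.
  have -> : C * d = n%:R * (Km * d) * (nN * B) + n%:R * `|mu q0| * (nN * (Km * d)).
    by rewrite /C; ring.
  rewrite (le_trans (ler_normD _ _))// lerD//.
    by apply: mulmx_le; [exact: mxd | apply: NmT; exact: mxB].
  by apply: mulmx_le => //; apply: NmT; exact: mxd.
Unshelve. all: by end_near. Qed.

End LocalBounds.

(** * The local error *)

Section Absorption.
Context {R : realType}.

(* Here [dq], [dv], [dl] stand for the sizes of the position, velocity and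
   multiplier errors, [w1] for that of the part of the velocity error not due to
   the multiplier error, and [w2] for that of [mu q *m dv]. *)
Lemma error_absorption (K : R) : 1 <= K ->
  exists (C e0 : R), [/\ 0 <= C, 0 < e0 &
    forall e dq dv dl w1 w2 : R, 0 < e <= e0 -> 0 <= dq -> 0 <= dv ->
      dq <= e * dv + K * e ^+ 3 ->
      w1 <= K * e * dq + K * e ^+ 3 ->
      w2 <= K * dq ->
      e * dl <= K * (w2 + K * w1) ->
      dv <= w1 + K * (e * dl) ->
      [/\ dq <= C * e ^+ 3, dv <= C * e ^+ 3 & dl <= C * e ^+ 2]].
Proof.
move=> K1; have K0 : 0 <= K by lra.
(* With P = dq + e^3, the hypotheses give e dl <= a P and dv <= b P, while P <= e dv + (K + 1) e^3.
   Once b e <= 1/2, the velocity term is absorbed: dv <= C1 e^3, and then P <= P1 e^3. *)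
pose a := K * (K + K * K); pose b := K + K * a.
have a0 : 0 <= a by rewrite mulr_ge0// addr_ge0// mulr_ge0.
have Ka0 : 0 <= K * a by rewrite mulr_ge0.
have b0 : 0 < b by rewrite /b; lra.
pose C1 := 2 * b * (K + 1); pose P1 := C1 + K + 1.
have C10 : 0 <= C1 by apply: mulr_ge0; [apply: mulr_ge0 => //; exact: ltW | lra].
have P10 : 0 <= P1 by rewrite /P1; lra.
have aP : 0 <= a * P1 by rewrite mulr_ge0.
exists (P1 + a * P1), (Num.min 1 (2 * b)^-1); split.
- by rewrite addr_ge0.
- by rewrite lt_min ltr01 invr_gt0 mulr_gt0.
move=> e dq dv dl w1 w2 /andP[e0]; rewrite le_min => /andP[e1 eb] dq0 dv0 h1 h2 h3 h4 h5.
have e3 : 0 <= e ^+ 3 by rewrite exprn_ge0// ltW.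
pose P := dq + e ^+ 3; have P0 : 0 <= P by rewrite addr_ge0.
have w1P : w1 <= K * P.
  rewrite (le_trans h2)// -mulrA -mulrDr ler_wpM2l// lerD2r.
  by rewrite ler_piMl.
have w2P : w2 <= K * P by rewrite (le_trans h3)// ler_wpM2l// lerDl.
have dlP : e * dl <= a * P.
  have -> : a * P = K * (K * P + K * (K * P)) by rewrite /a; ring.
  by rewrite (le_trans h4)// ler_wpM2l// lerD// ler_wpM2l.
have dvP : dv <= b * P.
  have -> : b * P = K * P + K * (a * P) by rewrite /b; ring.
  by rewrite (le_trans h5)// lerD// ler_wpM2l.
have PE : P <= e * dv + (K + 1) * e ^+ 3 by rewrite /P; lra.
have bdv : b * P <= b * e * dv + b * (K + 1) * e ^+ 3.
  by rewrite -!mulrA -mulrDr ler_wpM2l// ltW.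
have be : b * e <= 2^-1.
  by rewrite -ler_pdivlMl// -invfM [b * 2]mulrC.
have bedv : b * e * dv <= 2^-1 * dv by rewrite ler_wpM2r.
have dvC : dv <= C1 * e ^+ 3.
  have -> : C1 * e ^+ 3 = 2 * (b * (K + 1) * e ^+ 3) by rewrite /C1; ring.
  by lra.
have edv : e * dv <= C1 * e ^+ 3 by rewrite (le_trans _ dvC)// ler_piMl.
have PC : P <= P1 * e ^+ 3.
  have -> : P1 * e ^+ 3 = C1 * e ^+ 3 + (K + 1) * e ^+ 3 by rewrite /P1; ring.
  by lra.
have P1C : P1 * e ^+ 3 <= (P1 + a * P1) * e ^+ 3 by rewrite ler_wpM2r// lerDl.
have C1P : C1 * e ^+ 3 <= P1 * e ^+ 3 by rewrite ler_wpM2r// /P1; lra.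
split; [by rewrite /P in PC; lra | by lra |].
rewrite -(ler_pM2l e0) (le_trans dlP)//.
apply: (@le_trans _ _ (a * (P1 * e ^+ 3))); first by rewrite ler_wpM2l.
have -> : e * ((P1 + a * P1) * e ^+ 2) = P1 * e ^+ 3 + a * (P1 * e ^+ 3) by ring.
by rewrite lerDr mulr_ge0.
Qed.

End Absorption.

Section Error.
Context {R : realType} {n m : nat}.
Variables (M : 'M[R]_n) (V : 'cV[R]_n -> R) (mu : 'cV[R]_n -> 'M[R]_(m, n)).
Hypothesis M_posdef : sym_posdef M.
Hypothesis V_smooth : smooth V.
Hypothesis mu_smooth : forall (a : 'I_m) (i : 'I_n), smooth (fun q => mu q a i).
Hypothesis mu_free : forall q, row_free (mu q).

Lemma local_error (q v q' v' : R -> 'cV[R]_n) (l' : R -> 'cV[R]_m) :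
  flow_solution M V mu 0 q v ->
  is_branch (velocity_integrator M V mu) (q 0) (v 0) q' v' l' ->
  exists K : R, \forall e \near (0 : R)^'+,
    [/\ `|q e - q' e| <= K * e ^+ 3, `|v e - v' e| <= K * e ^+ 3 &
        `|lambda M V mu (q e) (v e) - l' e| <= K * e].
Proof.
move=> qv [step v'v _].
pose L e := lambda M V mu (q e) (v e).
have [K [K1 hK]] := local_step_bounds M_posdef V_smooth mu_smooth mu_free (q 0).
have /filter_ex[d [d0 hd]] : \forall d \near (0 : R)^'+, 0 < d /\
    forall x y, `|x - q 0| <= d -> `|y - q 0| <= d -> step_bounds M V mu K x y.
  by near=> d; split; near: d; [exact: nbhs_right_gt|exact: hK].
have qinc := position_increment M_posdef V_smooth mu_smooth mu_free qv.
have linc := lambda_increment M_posdef V_smooth mu_smooth mu_free qv.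
have [A1 [A10 hA1]] := Opow_right (position_quadrature M_posdef V_smooth mu_smooth mu_free qv).
have [A2 [A20 hA2]] := Opow_right (velocity_quadrature M_posdef V_smooth mu_smooth mu_free qv).
have [A3 [A30 hA3]] := Opow_right (Opow_half (position_linear M_posdef V_smooth mu_smooth mu_free qv)).
have [A4 [A40 hA4]] := Opow_right linc.
have [A5 [A50 hA5]] := Opow_right (Opow_half linc).
pose B := `|v 0| + 1.
have B0 : 0 <= B by rewrite addr_ge0.
pose BL := `|L 0| + 1.
have BL0 : 0 <= BL by rewrite addr_ge0.
(* Besides K, the terms account for the position quadrature, for the velocity quadrature together
   with the shift of the midpoint, and for the variation of the forms acting on v'. *)
pose K2 := K + A1 + (K * A3 * BL + A2) + K * B.
have KA3 : 0 <= K * A3 * BL by rewrite !mulr_ge0//; lra.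
have KB : 0 <= K * B by rewrite mulr_ge0//; lra.
have K21 : 1 <= K2 by rewrite /K2; lra.
have K2K : K <= K2 by rewrite /K2; lra.
have K20 : 0 <= K2 by lra.
have A1K2 : A1 <= K2 by rewrite /K2; lra.
have A2K2 : K * A3 * BL + A2 <= K2 by rewrite /K2; lra.
have KBK2 : K * B <= K2 by rewrite /K2; lra.
have v0BB : `|v 0| <= B + B by rewrite /B; have := normr_ge0 (v 0); lra.
have K0 : 0 <= K by lra.
have [C [e0 [C0 e00 absorb]]] := error_absorption K21.
have S0 : 0 <= C + A4 + A5 by lra.
exists (C + (C + A4 + A5)).
near=> e.
have e_gt0 : 0 < e by near: e; exact: nbhs_right_gt.
have e_ge0 := ltW e_gt0.
have e1 : e <= 1 by near: e; exact: nbhs_right_le.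
have ee0 : e <= e0 by near: e; exact: nbhs_right_le.
have e2_le : e ^+ 2 <= e by rewrite expr2 ler_piMl.
have e3_ge0 : 0 <= e ^+ 3 by rewrite exprn_ge0.
have half_e : `|2^-1 * e| <= e by rewrite ger0_norm ?mulr_ge0// ler_piMl// invf_le1// ler1n.
have [hq' hv' hD'] : velocity_integrator M V mu e (q 0) (v 0) (q' e) (v' e) (l' e).
  by near: e.
have hD : mu (q e) *m v e = 0.
  by near: e; apply: (cvg_at_right_filter cvg_id); apply: filterS qv => t [].
have v'1 : `|v' e - v 0| <= 1.
  by rewrite distrC; near: e; have /cvgrPdist_le := v'v; apply.
have v'B : `|v' e| <= B.
  by rewrite -[v' e](subrK (v 0)) (le_trans (ler_normD _ _))// addrC lerD2l.
have LB : `|L (e / 2)| <= BL.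
  rewrite -[L (e / 2)](subrK (L 0)) (le_trans (ler_normD _ _))// addrC lerD2l.
  by near: e; apply: Opow_small (Opow_half linc) _.
have small : e * (B + B) <= d.
  by near: e; apply: near_mul_le => //; rewrite addr_ge0.
have hA1e : `|q e - q 0 - (e / 2) *: (v 0 + v e)| <= A1 * e ^+ 3 by near: e.
have hA2e : `|v e - v 0 + (e / 2) *: (invmx M *m (grad V (q 0) + grad V (q e)))
    - e *: (invmx M *m (mu (q (e / 2)))^T *m L (e / 2))| <= A2 * e ^+ 3 by near: e.
have hA3e : `|q (e / 2) - q 0 - (e / 2) *: v 0| <= A3 * e ^+ 2 by near: e.
have hA4e : `|L e - L 0| <= A4 * e by near: e.
have hA5e : `|L (e / 2) - L 0| <= A5 * e by near: e.
have qd : `|q e - q 0| <= d by near: e; exact: Opow_small qinc d0.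
have qhd : `|q (e / 2) - q 0| <= d by near: e; exact: Opow_small (Opow_half qinc) d0.
move: hA1e hA2e hA3e; rewrite (mulrC e 2^-1).
set y := q (2^-1 * e); set Lh := L (2^-1 * e) => hA1e hA2e hA3e.
move: qhd LB hA5e; rewrite (mulrC e 2^-1) -/y -/Lh => qhd LB hA5e.
pose qh := q 0 + (2^-1 * e) *: v 0.
have qh0d : `|qh - q 0| <= d.
  rewrite /qh addrC addKr normrZ (le_trans _ small)//.
  exact: ler_pM.
have q'd : `|q' e - q 0| <= d.
  rewrite hq' -[q 0 + _ + _]addrA [q 0 + _]addrC addrK -scalerDr normrZ (le_trans _ small)//.
  apply: ler_pM => //; rewrite (le_trans (ler_normD _ _))// lerD//.
  by rewrite /B lerDl.
pose N := invmx M.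
(* The multiplier is compared with its exact value at the midpoint: only there
   is the discrete reaction force accurate to second order. *)
pose dq := q' e - q e; pose dv := v' e - v e; pose dl := l' e - Lh.
pose w := dv - e *: (N *m (mu qh)^T *m dl).
have b1 := hd _ _ q'd qd.
have b2 := hd _ _ qd q'd.
have b3 := hd _ _ qd qh0d.
have b4 := hd _ _ qh0d qhd.
have h1 : `|dq| <= e * `|dv| + K2 * e ^+ 3.
  have -> : dq = (2^-1 * e) *: dv - (q e - q 0 - (2^-1 * e) *: (v 0 + v e)).
    by rewrite /dq hq' /dv; apply/matrixP => i j; rewrite !mxE; ring.
  rewrite (le_trans (ler_normB _ _))// lerD//; first by rewrite normrZ ler_wpM2r.
  by rewrite (le_trans hA1e)// ler_wpM2r.
have h2 : `|w| <= K2 * e * `|dq| + K2 * e ^+ 3.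
  (* Three sources: the force at the wrong end point, the forms at the wrong midpoint, and the
     quadrature error of the exact velocity. *)
  have -> : w = - ((2^-1 * e) *: (N *m (grad V (q' e) - grad V (q e))))
    + e *: (N *m (mu qh - mu y)^T *m Lh)
    - (v e - v 0 + (2^-1 * e) *: (N *m (grad V (q 0) + grad V (q e)))
       - e *: (N *m (mu y)^T *m Lh)).
    have trB : (mu qh - mu y)^T = (mu qh)^T - (mu y)^T by rewrite raddfB.
    rewrite /w /dv hv' -/qh -/N /dl trB !mulmxBr !mulmxBl !mulmxDr.
    move: (N *m grad V (q' e)) (N *m grad V (q e)) (N *m grad V (q 0)) => g1 g2 g3.
    move: (N *m (mu qh)^T *m l' e) (N *m (mu qh)^T *m Lh) (N *m (mu y)^T *m Lh) => r1 r2 r3.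
    by apply/matrixP => i j; rewrite !mxE; ring.
  rewrite (le_trans (ler_normB _ _))//.
  have t1 : `|- ((2^-1 * e) *: (N *m (grad V (q' e) - grad V (q e))))| <= K2 * e * `|dq|.
    rewrite normrN normrZ mulrAC mulrC; apply: ler_pM => //.
    by rewrite (le_trans (force_lip b1))// ler_wpM2r.
  have t2 : `|e *: (N *m (mu qh - mu y)^T *m Lh)| <= K * A3 * BL * e ^+ 3.
    rewrite normrZ (ger0_norm e_ge0).
    have -> : K * A3 * BL * e ^+ 3 = e * (K * (A3 * e ^+ 2) * BL) by ring.
    rewrite ler_wpM2l// (le_trans (reaction_lip b4 _))//.
    apply: ler_pM => //; first by rewrite mulr_ge0.
    rewrite ler_wpM2l// distrC (le_trans _ hA3e)//.
    by rewrite /qh opprD addrA.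
  have t3 : K * A3 * BL * e ^+ 3 + A2 * e ^+ 3 <= K2 * e ^+ 3.
    by rewrite -mulrDl ler_wpM2r.
  have -> : K2 * e * `|dq| + K2 * e ^+ 3 = K2 * e * `|dq| + (K2 * e ^+ 3 - A2 * e ^+ 3) + A2 * e ^+ 3.
    by rewrite -addrA subrK.
  rewrite lerD// (le_trans (ler_normD _ _))// lerD// (le_trans t2)//.
  by rewrite lerBrDr.
have h3 : `|mu (q e) *m dv| <= K2 * `|dq|.
  (* Each velocity satisfies the constraint at its own position, so only the variation of the forms
     remains. *)
  have -> : mu (q e) *m dv = (mu (q e) - mu (q' e)) *m v' e.
    by rewrite /dv mulmxBr mulmxBl hD hD'.
  rewrite (le_trans (form_lip b2 _))// distrC mulrAC ler_wpM2r//.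
  by rewrite (le_trans _ KBK2)// ler_wpM2l.
have h4 : e * `|dl| <= K2 * (`|mu (q e) *m dv| + K2 * `|w|).
  (* Applying the forms at [q e] to dv = w + e M^-1 mu(qh)^T dl isolates the multiplier error, which
     coercivity then bounds. *)
  have e_dl : e *: (mu (q e) *m (N *m (mu qh)^T *m dl)) = mu (q e) *m dv - mu (q e) *m w.
    by rewrite -mulmxBr /w opprB addrC subrK scalemxAr.
  have : e * `|dl| <= K * `|e *: (mu (q e) *m (N *m (mu qh)^T *m dl))|.
    by rewrite normrZ (ger0_norm e_ge0) mulrCA ler_wpM2l// (gram_coercive b3).
  move=> /le_trans; apply; rewrite e_dl; apply: ler_pM => //.
  rewrite (le_trans (ler_normB _ _))// lerD2l (le_trans (form_le b3 _))//.
  by rewrite ler_wpM2r.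
have h5 : `|dv| <= `|w| + K2 * (e * `|dl|).
  rewrite -[dv](subrK (e *: (N *m (mu qh)^T *m dl))) -/w (le_trans (ler_normD _ _))//.
  rewrite lerD2l normrZ (ger0_norm e_ge0) mulrCA ler_wpM2l//.
  by rewrite (le_trans (reaction_le b4 _))// ler_wpM2r.
have [|c1 c2 c3] := absorb e _ _ _ _ _ _ (normr_ge0 _) (normr_ge0 _) h1 h2 h3 h4 h5.
  by rewrite e_gt0.
split.
- by rewrite distrC (le_trans c1)// ler_wpM2r// lerDl.
- by rewrite distrC (le_trans c2)// ler_wpM2r// lerDl.
have c4 : `|dl| <= C * e by rewrite (le_trans c3)// ler_wpM2l.
(* The passage from the midpoint to the end time goes through the value at 0, at a cost of O(e). *)
have splitE (l1 l2 l3 l4 : 'cV[R]_m) : l1 - l4 = (l1 - l2) - (l3 - l2) - (l4 - l3).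
  by apply/matrixP => i j; rewrite !mxE; ring.
rewrite -/(L e) (splitE (L e) (L 0) Lh (l' e)) -/dl.
rewrite (le_trans (ler_normB _ _))//.
have -> : (C + (C + A4 + A5)) * e = A4 * e + A5 * e + C * e + C * e by ring.
rewrite -[leLHS]addr0 !lerD//; last by rewrite mulr_ge0.
by rewrite (le_trans (ler_normB _ _))// lerD.
Unshelve. all: by end_near. Qed.

End Error.

(** * Existence of a branch *)

(** Lets completeness and the norm be found together on vectors, as [ball_fixed_point] asks. *)
HB.instance Definition _ (R : realType) m n := Complete.on 'M[R]_(m, n).

Section FixedPoint.
Context {R : realType}.

(** Banach's theorem on a closed ball: the estimates for the step hold only for bounded
    accelerations. *)
Lemma ball_fixed_point (X : completeNormedModType R) (f : X -> X) (B : R) :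
  0 <= B -> (forall x, `|x| <= B -> `|f x| <= B) ->
  (forall x y, `|x| <= B -> `|y| <= B -> `|f x - f y| <= 2^-1 * `|x - y|) ->
  exists2 x, `|x| <= B & x = f x.
Proof.
move=> B0 fB fL; pose U : set X := closed_ball_ (fun x => `|x|) 0 B.
have UE x : U x <-> `|x| <= B by rewrite /U /closed_ball_/= sub0r normrN.
have fU : {homo f : x / U x >-> U x} by move=> x /UE/fB/UE.
have [|||x /UE xB xE] := @banach_fixed_point R X U (mkfun_fun fU).
- exists (2^-1)%:nng; split; first by rewrite /= invf_lt1 ?ltr1n.
  by move=> [x y] /= [/UE xB /UE yB]; exact: fL.
- exact: closed_closed_ball_.
- by exists 0; apply/UE; rewrite normr0.
by exists x.
Qed.

Lemma mulmx_inj_unitmx m (A : 'M[R]_m) :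
  (forall l : 'cV[R]_m, A *m l = 0 -> l = 0) -> A \in unitmx.
Proof.
move=> inj; rewrite -unitmx_tr -row_free_unit; apply: inj_row_free => x xA.
by apply: trmx_inj; rewrite trmx0; apply: inj; rewrite -[A]trmxK -trmx_mul xA trmx0.
Qed.

End FixedPoint.

Section Existence.
Context {R : realType} {n m : nat}.
Variables (M : 'M[R]_n) (V : 'cV[R]_n -> R) (mu : 'cV[R]_n -> 'M[R]_(m, n)).
Variables (q v : 'cV[R]_n).

(* The step is solved for the discrete acceleration [a = (v' - v) / e]. *)
Definition step_position (e : R) (a : 'cV[R]_n) : 'cV[R]_n :=
  q + (2^-1 * e) *: v + (2^-1 * e) *: (v + e *: a).

Definition step_force e a : 'cV[R]_n :=
  2^-1 *: (invmx M *m (grad V (step_position e a) + grad V q)).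

Definition step_gram e a : 'M[R]_m :=
  mu (step_position e a) *m (invmx M *m (mu (q + (2^-1 * e) *: v))^T).

(* Uses [mu q *m v = 0] to divide the constraint [mu q' *m v' = 0] by [e]. *)
Definition step_rhs e a : 'cV[R]_m :=
  mu (step_position e a) *m step_force e a
  - e^-1 *: ((mu (step_position e a) - mu q) *m v).

Definition step_multiplier e a : 'cV[R]_m := invmx (step_gram e a) *m step_rhs e a.

Definition step_acceleration e a : 'cV[R]_n :=
  - step_force e a
  + invmx M *m (mu (q + (2^-1 * e) *: v))^T *m step_multiplier e a.

(** At a fixed point the multiplier makes mu(q') a equal to - e^-1 (mu(q') - mu(q)) v. Multiplied by
    e and added to mu(q') v, this leaves mu(q) v = 0. *)
Lemma step_fixed_point e a : inD mu q v -> e != 0 -> step_gram e a \in unitmx ->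
  a = step_acceleration e a ->
  velocity_integrator M V mu e q v (step_position e a) (v + e *: a)
    (step_multiplier e a).
Proof.
move=> qv e0 uA aE; split=> //.
  rewrite -addrA; congr (_ + _); rewrite {1}aE /step_acceleration scalerDr scalerN.
  by congr (- _ + _); rewrite /step_force scalerA mulrC.
have Aa : mu (step_position e a) *m a = - (e^-1 *: ((mu (step_position e a) - mu q) *m v)).
  rewrite {2}aE /step_acceleration mulmxDr mulmxN.
  rewrite [mu _ *m (_ *m step_multiplier e a)]mulmxA -/(step_gram e a).
  by rewrite [step_gram e a *m _]mulKVmx// /step_rhs addKr.
rewrite /inD mulmxDr -scalemxAr Aa scalerN scalerA divff// scale1r mulmxBl.
by rewrite (qv : mu q *m v = 0) subr0 subrr.
Qed.

(** Thanks to e B <= 1 the bound is free of B. Otherwise it would be circular to choose B from the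
    estimates that follow. *)
Lemma step_position_dist e a (B : R) : 0 <= e -> e * B <= 1 -> `|a| <= B ->
  `|step_position e a - q| <= e * (`|v| + 1).
Proof.
move=> e0 eB aB.
have -> : step_position e a - q = e *: (v + (2^-1 * e) *: a).
  by rewrite /step_position; apply/matrixP => i j; rewrite !mxE; field.
rewrite normrZ (ger0_norm e0) ler_wpM2l// (le_trans (ler_normD _ _))// lerD2l.
rewrite normrZ ger0_norm ?mulr_ge0// -mulrA.
have : e * `|a| <= 1 by rewrite (le_trans _ eB)// ler_wpM2l.
have : 0 <= e * `|a| by rewrite mulr_ge0.
lra.
Qed.

(** The factor e^2 is what later compensates the e^-1 in [step_rhs]. *)
Lemma step_position_lip e a1 a2 : 0 <= e ->
  `|step_position e a1 - step_position e a2| <= e ^+ 2 * `|a1 - a2|.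
Proof.
move=> e0.
have -> : step_position e a1 - step_position e a2 = (2^-1 * e ^+ 2) *: (a1 - a2).
  by rewrite /step_position; apply/matrixP => i j; rewrite !mxE; ring.
rewrite normrZ ler_wpM2r// ger0_norm ?mulr_ge0 ?exprn_ge0//.
by rewrite ler_piMl ?exprn_ge0// invf_le1// ler1n.
Qed.

(** * Estimates on a ball of discrete accelerations *)

Section Contraction.
Variables (K d e B : R).
Hypothesis K0 : 0 <= K.
Hypothesis bounds : forall x y, `|x - q| <= d -> `|y - q| <= d ->
  step_bounds M V mu K x y.
Hypotheses (e0 : 0 < e) (e1 : e <= 1) (eB : e * B <= 1) (ed : e * (`|v| + 1) <= d).

Let N := invmx M.
Let qh := q + (2^-1 * e) *: v.
Let bnd := K * K + K * (`|v| + 1) * `|v|.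

Let pos_d a : `|a| <= B -> `|step_position e a - q| <= d.
Proof. by move=> aB; rewrite (le_trans (step_position_dist (ltW e0) eB aB)). Qed.

Let q_d : `|q - q| <= d.
Proof. by rewrite subrr normr0 (le_trans _ ed)// mulr_ge0 ?addr_ge0// ltW. Qed.

Let qh_d : `|qh - q| <= d.
Proof.
rewrite /qh addrC addKr normrZ (le_trans _ ed)// ger0_norm ?mulr_ge0 ?(ltW e0)//.
by apply: ler_pM; rewrite ?mulr_ge0 ?(ltW e0) ?lerDl// ler_piMl ?(ltW e0)// invf_le1// ler1n.
Qed.

Lemma step_force_le a : `|a| <= B -> `|step_force e a| <= K.
Proof.
move=> aB; rewrite /step_force mulmxDr normrZ ger0_norm//.
have h1 := force_le (bounds (pos_d aB) q_d).
have h2 := force_le (bounds q_d q_d).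
rewrite mulrC ler_pdivrMr// (le_trans (ler_normD _ _))//.
by rewrite (le_trans (lerD h1 h2))// mulrDr mulr1.
Qed.

Lemma step_force_lip a1 a2 : `|a1| <= B -> `|a2| <= B ->
  `|step_force e a1 - step_force e a2| <= K * (e ^+ 2 * `|a1 - a2|).
Proof.
move=> a1B a2B; have E (g1 g2 g0 : 'cV[R]_n) :
    2^-1 *: (N *m (g1 + g0)) - 2^-1 *: (N *m (g2 + g0)) = 2^-1 *: (N *m (g1 - g2)).
  by rewrite -scalerBr -mulmxBr opprD addrACA subrr addr0.
rewrite [X in `|X|](E (grad V _) (grad V _) (grad V q)).
rewrite normrZ ger0_norm// (le_trans (ler_piMl _ _))//.
  by rewrite invf_le1// ler1n.
rewrite (le_trans (force_lip (bounds (pos_d a1B) (pos_d a2B))))// ler_wpM2l//.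
exact/step_position_lip/ltW.
Qed.

Lemma step_rhs_le a : `|a| <= B -> `|step_rhs e a| <= bnd.
Proof.
move=> aB; have b := bounds (pos_d aB) q_d.
rewrite (le_trans (ler_normB _ _))// lerD//.
  by rewrite (le_trans (form_le b _))// ler_wpM2l// step_force_le.
rewrite normrZ normfV (ger0_norm (ltW e0)) mulrC ler_pdivrMr//.
rewrite (le_trans (form_lip b _))// [leRHS]mulrAC ler_wpM2r// -mulrA ler_wpM2l//.
by rewrite mulrC (step_position_dist (ltW e0) eB).
Qed.

Lemma step_gram_unitmx a : `|a| <= B -> step_gram e a \in unitmx.
Proof.
move=> aB; apply: mulmx_inj_unitmx => l Al.
have := gram_coercive (bounds (pos_d aB) qh_d) l.
by rewrite mulmxA -/(step_gram e a) Al normr0 mulr0 normr_le0 => /eqP.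
Qed.

Lemma step_multiplier_le a : `|a| <= B -> `|step_multiplier e a| <= K * bnd.
Proof.
move=> aB; have := gram_coercive (bounds (pos_d aB) qh_d) (step_multiplier e a).
rewrite mulmxA -/(step_gram e a) [step_gram e a *m _]mulKVmx ?step_gram_unitmx//.
by move=> /le_trans; apply; rewrite ler_wpM2l// step_rhs_le.
Qed.

Lemma step_acceleration_le a : `|a| <= B ->
  `|step_acceleration e a| <= K + K * (K * bnd).
Proof.
move=> aB; rewrite (le_trans (ler_normD _ _))// lerD ?normrN ?step_force_le//.
rewrite (le_trans (reaction_le (bounds qh_d q_d) _))// ler_wpM2l//.
exact: step_multiplier_le.
Qed.

(** The base forms [mu q] cancel in the difference of the divided terms, so e^-1 meets a position
    difference of size e^2 and one factor e survives. *)
Lemma step_rhs_lip a1 a2 : `|a1| <= B -> `|a2| <= B ->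
  `|step_rhs e a1 - step_rhs e a2| <= (2 * K * K + K * `|v|) * (e * `|a1 - a2|).
Proof.
move=> a1B a2B; have b := bounds (pos_d a1B) (pos_d a2B).
have D := step_position_lip a1 a2 (ltW e0).
have e2 : e ^+ 2 * `|a1 - a2| <= e * `|a1 - a2|.
  by rewrite ler_wpM2r// expr2 ler_piMl// ltW.
have De := le_trans D e2.
have -> : step_rhs e a1 - step_rhs e a2 =
    mu (step_position e a1) *m (step_force e a1 - step_force e a2)
    + (mu (step_position e a1) - mu (step_position e a2)) *m step_force e a2
    - e^-1 *: ((mu (step_position e a1) - mu (step_position e a2)) *m v).
  have E (m1 m2 m0 : 'M[R]_(m, n)) (f1 f2 : 'cV[R]_n) (c : R) :
      (m1 *m f1 - c *: ((m1 - m0) *m v)) - (m2 *m f2 - c *: ((m2 - m0) *m v)) =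
      m1 *m (f1 - f2) + (m1 - m2) *m f2 - c *: ((m1 - m2) *m v).
    rewrite mulmxBr !mulmxBl.
    move: (m1 *m f1) (m1 *m f2) (m2 *m f2) (m1 *m v) (m2 *m v) (m0 *m v).
    by move=> w1 w2 w3 u1 u2 u3; apply/matrixP => i j; rewrite !mxE; ring.
  exact: E.
rewrite (le_trans (ler_normB _ _))// mulrDl lerD//.
  rewrite (le_trans (ler_normD _ _))//.
  have -> : 2 * K * K * (e * `|a1 - a2|) = K * (K * (e * `|a1 - a2|)) + K * (e * `|a1 - a2|) * K.
    by ring.
  rewrite lerD//.
    rewrite (le_trans (form_le b _))// ler_wpM2l//.
    by rewrite (le_trans (step_force_lip a1B a2B))// ler_wpM2l.
  rewrite (le_trans (form_lip b _))//; apply: ler_pM; rewrite ?mulr_ge0//.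
    by rewrite ler_wpM2l.
  exact: step_force_le.
rewrite normrZ normfV (ger0_norm (ltW e0)) mulrC ler_pdivrMr//.
rewrite (le_trans (form_lip b _))// mulrAC -!mulrA !ler_wpM2l// mulrCA.
by rewrite (le_trans D)// expr2 mulrC.
Qed.

Let mult_lip := K * (2 * K * K + K * `|v| + K * (K * (K * bnd))).

(** The two multipliers solve systems with different matrices: A1 (l1 - l2) = r1 - r2 - (A1 - A2)
    l2. Coercivity of A1 and the bound on l2 finish, with no estimate on a difference of
    inverses. *)
Lemma step_multiplier_lip a1 a2 : `|a1| <= B -> `|a2| <= B ->
  `|step_multiplier e a1 - step_multiplier e a2| <= mult_lip * (e * `|a1 - a2|).
Proof.
move=> a1B a2B; have b := bounds (pos_d a1B) (pos_d a2B).
have D := step_position_lip a1 a2 (ltW e0).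
have e2 : e ^+ 2 * `|a1 - a2| <= e * `|a1 - a2|.
  by rewrite ler_wpM2r// expr2 ler_piMl// ltW.
set l1 := step_multiplier e a1; set l2 := step_multiplier e a2.
have := gram_coercive (bounds (pos_d a1B) qh_d) (l1 - l2).
have -> : mu (step_position e a1) *m (invmx M *m (mu qh)^T *m (l1 - l2)) =
    step_rhs e a1 - step_rhs e a2
    - (mu (step_position e a1) - mu (step_position e a2)) *m (invmx M *m (mu qh)^T *m l2).
  have E1 : step_gram e a1 *m l1 = step_rhs e a1 by rewrite mulKVmx ?step_gram_unitmx.
  have E2 : step_gram e a2 *m l2 = step_rhs e a2 by rewrite mulKVmx ?step_gram_unitmx.
  have E (m1 m2 : 'M[R]_(m, n)) (P : 'M[R]_(n, m)) (k1 k2 : 'cV[R]_m) :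
      m1 *m (P *m (k1 - k2)) =
      m1 *m P *m k1 - m2 *m P *m k2 - (m1 - m2) *m (P *m k2).
    rewrite !mulmxBr mulmxBl !mulmxA.
    move: (m1 *m P *m k1) (m1 *m P *m k2) (m2 *m P *m k2) => w1 w2 w3.
    by apply/matrixP => i j; rewrite !mxE; ring.
  by rewrite -E1 -E2; exact: E.
move=> /le_trans; apply; rewrite /mult_lip -mulrA ler_wpM2l//.
rewrite mulrDl (le_trans (ler_normB _ _))// lerD ?step_rhs_lip//.
rewrite (le_trans (form_lip b _))// mulrAC -[K * (K * (K * bnd))]/(K * _) -mulrA.
rewrite -mulrA ler_wpM2l//; apply: ler_pM => //; last by rewrite (le_trans D).
rewrite (le_trans (reaction_le (bounds qh_d q_d) _))// ler_wpM2l//.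
exact: step_multiplier_le.
Qed.

Lemma step_acceleration_lip a1 a2 : `|a1| <= B -> `|a2| <= B ->
  `|step_acceleration e a1 - step_acceleration e a2|
    <= (K + K * mult_lip) * e * `|a1 - a2|.
Proof.
move=> a1B a2B.
have e2 : e ^+ 2 * `|a1 - a2| <= e * `|a1 - a2|.
  by rewrite ler_wpM2r// expr2 ler_piMl// ltW.
have -> : step_acceleration e a1 - step_acceleration e a2 =
   - (step_force e a1 - step_force e a2)
   + invmx M *m (mu qh)^T *m (step_multiplier e a1 - step_multiplier e a2).
  have E (f1 f2 : 'cV[R]_n) (P : 'M[R]_(n, m)) (k1 k2 : 'cV[R]_m) :
      (- f1 + P *m k1) - (- f2 + P *m k2) = - (f1 - f2) + P *m (k1 - k2).
    rewrite mulmxBr; move: (P *m k1) (P *m k2) => w1 w2.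
    by apply/matrixP => i j; rewrite !mxE; ring.
  exact: E.
rewrite -mulrA mulrDl (le_trans (ler_normD _ _))// normrN lerD//.
  by rewrite (le_trans (step_force_lip a1B a2B))// ler_wpM2l.
rewrite (le_trans (reaction_le (bounds qh_d q_d) _))// -mulrA ler_wpM2l//.
exact: step_multiplier_lip.
Qed.

End Contraction.

Hypothesis M_posdef : sym_posdef M.
Hypothesis V_smooth : smooth V.
Hypothesis mu_smooth : forall (a : 'I_m) (i : 'I_n), smooth (fun q => mu q a i).
Hypothesis mu_free : forall q, row_free (mu q).

Lemma branch_exists : inD mu q v ->
  exists (q' v' : R -> 'cV[R]_n) (l' : R -> 'cV[R]_m),
    is_branch (velocity_integrator M V mu) q v q' v' l'.
Proof.
move=> qv.
have [K [K1 hK]] := local_step_bounds M_posdef V_smooth mu_smooth mu_free q.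
have K0 : 0 <= K by rewrite (le_trans _ K1).
have /filter_ex[d [d0 hd]] : \forall d \near (0 : R)^'+, 0 < d /\
    forall x y, `|x - q| <= d -> `|y - q| <= d -> step_bounds M V mu K x y.
  by near=> d; split; near: d; [exact: nbhs_right_gt|exact: hK].
pose bnd := K * K + K * (`|v| + 1) * `|v|.
have bnd0 : 0 <= bnd by rewrite addr_ge0 ?mulr_ge0// addr_ge0.
(* The radius is the bound of [step_acceleration_le], so the ball is mapped into itself. *)
pose B := K + K * (K * bnd).
have B0 : 0 <= B by rewrite addr_ge0 ?mulr_ge0.
pose C := K + K * (K * (2 * K * K + K * `|v| + K * (K * (K * bnd)))).
have C0 : 0 <= C by rewrite !(addr_ge0, mulr_ge0).
pose small (e : R) := [/\ 0 < e, e <= 1, e * B <= 1, e * (`|v| + 1) <= d & e * C <= 2^-1].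
have small_near : \forall e \near (0 : R)^'+, small e.
  near=> e; split; near: e.
  - exact: nbhs_right_gt.
  - exact: nbhs_right_le.
  - exact: near_mul_le.
  - by apply: near_mul_le => //; rewrite addr_ge0.
  - by apply: near_mul_le => //; rewrite invr_gt0.
(* Fixed points are chosen for all e at once, with default 0 when e is not small. *)
have /choice[a ha] : forall e, exists a, small e ->
    `|a| <= B /\ a = step_acceleration e a.
  move=> e; case: (pselect (small e)) => [[e0 e1 eB ed eC]|ne]; last by exists 0.
  have [||x xB xE] := @ball_fixed_point R _ (step_acceleration e) B B0.
  - by move=> x xB; exact: (step_acceleration_le K0 hd e0 eB ed xB).
  - move=> x y xB yB.
    rewrite (le_trans (step_acceleration_lip K0 hd e0 e1 eB ed xB yB))//.
    by rewrite ler_wpM2r// mulrC.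
  by exists x.
exists (fun e => step_position e (a e)), (fun e => v + e *: a e),
  (fun e => step_multiplier e (a e)); split.
- apply: filterS small_near => e se; have [aB aE] := ha e se.
  have [e0 e1 eB ed _] := se.
  apply: step_fixed_point => //; first by rewrite gt_eqF.
  exact: (step_gram_unitmx hd e0 eB ed aB).
- apply/cvgrPdist_le => c c0; near=> e.
  have se : small e by near: e.
  have [aB _] := ha e se; have [e0 _ _ _ _] := se.
  rewrite opprD addNKr normrN normrZ (ger0_norm (ltW e0)).
  apply: (@le_trans _ _ (e * B)); first by rewrite ler_wpM2l// ltW.
  by near: e; exact: near_mul_le.
- exists (K * bnd); apply: filterS small_near => e se.
  have [aB aE] := ha e se; have [e0 e1 eB ed _] := se.
  exact: (step_multiplier_le K0 hd e0 eB ed aB).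
Unshelve. all: by end_near. Qed.

End Existence.

Theorem proposition6p2 (R : realType) (n m : nat)
  (M : 'M[R]_n) (V : 'cV[R]_n -> R) (mu : 'cV[R]_n -> 'M[R]_(m, n))
  (M_posdef : sym_posdef M)
  (V_smooth : smooth V)
  (mu_smooth : forall (a : 'I_m) (i : 'I_n), smooth (fun q => mu q a i))
  (mu_free : forall q, row_free (mu q)) :
  consistent_discretization M V mu 2 0 (velocity_integrator M V mu).
Proof.
exists 2%N, 2%N; split=> // qk vk qvk; split; first exact: branch_exists.
move=> q' v' l' br; split.
  by have [st _ _] := br; apply: filterS st => e [].
move=> tk q v qv qtk vtk; have qv0 := flow_solution_shift qv.
have [|K hK] := local_error M_posdef V_smooth mu_smooth mu_free qv0 (q' := q') (v' := v') (l' := l').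
  by rewrite !addr0 qtk vtk.
have bound (W : normedModType R) k (f : R -> W) :
    (\forall e \near (0 : R)^'+, `|f e| <= K * e ^+ k) ->
    f =O_ (0^'+) (fun e : R => e ^+ k).
  (* The sign of K is unknown, and a positive constant is required. *)
  move=> hf; apply/eqO_exP; exists (`|K| + 1); first by rewrite ltr_wpDl.
  near=> e; have e0 : 0 <= e by near: e; exact: nbhs_right_ge.
  have : `|f e| <= K * e ^+ k by near: e.
  move=> /le_trans; apply; rewrite (ger0_norm (exprn_ge0 k e0)) ler_wpM2r ?exprn_ge0//.
  by rewrite (le_trans (ler_norm _))// lerDl.
by split; apply: bound; apply: filterS hK => e [].
Unshelve. all: by end_near. Qed.
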